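(* Let $Z$ be a set of double points in $\mathbb{P}^1\times\mathbb{P}^1$ whose support is arithmetically Cohen-Macaulay. Regard $S/I_Z$ as a graded ring with respect to the total (standard) grading of $S=k[x_0,x_1,y_0,y_1]$, and let $p=\operatorname{projdim}(S/I_Z)$. Then for every $i=1,\ldots,p$, $$\beta_i(S/I_Z)\le\frac{1}{(i-1)!\,(p-i)!}\prod_{1\le j\le p,\ j\ne i}M_j,$$ where $M_j=\max\{d : \beta_{j,d}(S/I_Z)\ne0\}$.
   Context: $k$ is an algebraically closed field of characteristic zero, and $S=k[x_0,x_1,y_0,y_1]$ is $\mathbb{N}^2$-graded with $\deg x_i=(1,0)$, $\deg y_i=(0,1)$; it is the coordinate ring of $\mathbb{P}^1\times\mathbb{P}^1$. A point $P=R\times Q$ has defining ideal $I_P=(L_R,L_Q)$, where $L_R$ (degree $(1,0)$) and $L_Q$ (degree $(0,1)$) are linear forms vanishing at $R$, resp. $Q$. A set of double points $Z$ with support a finite set of points $X$ has defining ideal $I_Z=\bigcap_{P\in X}I_P^2$. A set of points $X$ with ideal $I_X=\bigcap_{P\in X}I_P$ is arithmetically Cohen-Macaulay (ACM) if $S/I_X$ is Cohen-Macaulay. The total grading is $(S/I_Z)_i=\bigoplus_{a+b=i}(S/I_Z)_{a,b}$. If $0\to\mathbb{F}_p\to\cdots\to\mathbb{F}_1\to S\to S/I_Z\to0$ is the graded minimal free resolution, with $\mathbb{F}_i=\bigoplus_{d}S(-d)^{\beta_{i,d}(S/I_Z)}$, then $\beta_{i,d}(S/I_Z)$ are the graded Betti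 numbers and $\beta_i(S/I_Z)=\sum_d\beta_{i,d}(S/I_Z)$ is the $i$th Betti number. *)

(* Defs.v *)
From HB Require Import structures.
From mathcomp Require Import all_boot all_order all_algebra.
From mathcomp Require Import mpoly.

Set Implicit Arguments.
Unset Strict Implicit.
Unset Printing Implicit Defensive.

Import Order.TTheory GRing.Theory Num.Theory.
Local Open Scope ring_scope.

(* Ideals are [Prop]-valued predicates on the ring, and a quotient ring [A/I]
   is handled through the ideals and elements of [A]. *)

Section Ideals.
Variable A : comNzRingType.
Implicit Types (I J m : A -> Prop).

Definition subideal I J : Prop := forall a, I a -> J a.

Definition is_ideal J : Prop :=
  [/\ J 0, (forall a b, J a -> J b -> J (a + b))
    & (forall a b, J b -> J (a * b))].

Definition is_prime_ideal J : Prop :=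
  [/\ is_ideal J, ~ J 1 & forall a b, J (a * b) -> J a \/ J b].

Definition is_maximal_ideal m : Prop :=
  [/\ is_ideal m, ~ m 1
    & forall J, is_ideal J -> ~ J 1 -> subideal m J -> subideal J m].

Definition ideal_gen (G : A -> Prop) : A -> Prop := fun f =>
  exists (n : nat) (a g : 'I_n -> A),
    (forall i, G (g i)) /\ f = \sum_(i < n) a i * g i.

Definition ideal_mul I J : A -> Prop :=
  ideal_gen (fun h => exists f g, [/\ I f, J g & h = f * g]).

Definition ideal_adjoin I (fs : seq A) : A -> Prop :=
  ideal_gen (fun h => I h \/ h \in fs).

(* [fs] is a regular sequence on [A/I]. *)
Definition regular_seq I (fs : seq A) : Prop :=
  ~ ideal_adjoin I fs 1 /\
  forall i, (i < size fs)%N -> forall g,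
    ideal_adjoin I (take i fs) (fs`_i * g) -> ideal_adjoin I (take i fs) g.

(* [depth (m, A/I) = n]: the maximal length of a regular sequence on [A/I]
   inside [m]. *)
Definition is_depth I m (n : nat) : Prop :=
  let inm fs := regular_seq I fs /\ forall f, f \in fs -> m f in
  (exists2 fs, inm fs & size fs = n) /\
  (forall fs, inm fs -> (size fs <= n)%N).

(* A strict chain [c 0 < ... < c n] of primes between [I] and [m]. *)
Definition prime_chain I m (n : nat) (c : nat -> A -> Prop) : Prop :=
  [/\ forall i, (i <= n)%N -> is_prime_ideal (c i),
      subideal I (c 0%N),
      subideal (c n) m
    & forall i, (i < n)%N ->
        subideal (c i) (c i.+1) /\ exists2 a, c i.+1 a & ~ c i a].

(* The codimension (height) of [m/I] in [A/I], for [m] prime. *)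
Definition is_codim I m (n : nat) : Prop :=
  (exists c, prime_chain I m n c) /\
  (forall n' c, prime_chain I m n' c -> (n' <= n)%N).

(* For Noetherian [A]: [A/I] is Cohen-Macaulay iff depth and codimension agree
   at every maximal ideal of [A/I]. *)
Definition quotient_cohen_macaulay I : Prop :=
  forall m, is_maximal_ideal m -> subideal I m ->
    exists n, is_depth I m n /\ is_codim I m n.

End Ideals.

Section ProjectiveDimension.
Variable A : comNzRingType.

Definition is_projective (P : lmodType A) : Prop :=
  forall (M N : lmodType A) (g : {linear M -> N}) (f : {linear P -> N}),
    (forall y, exists x, g x = y) ->
    exists h : {linear P -> M}, forall x, g (h x) = f x.

(* [0 -> P_n -> ... -> P_0 -> M -> 0]; the [P_i] with [i > n] are zero. *)
Definition has_projective_resolution (M : lmodType A) (n : nat) : Prop :=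
  exists (P : nat -> lmodType A) (d : forall i, {linear P i.+1 -> P i})
         (e : {linear P 0%N -> M}),
    [/\ forall i, is_projective (P i),
        forall i, (n < i)%N -> forall x : P i, x = 0,
        forall y, exists x, e x = y,
        forall x, e x = 0 <-> exists y, d 0%N y = x
      & forall i x, d i x = 0 <-> exists y, d i.+1 y = x].

Definition is_projdim (M : lmodType A) (n : nat) : Prop :=
  has_projective_resolution M n /\
  forall q, has_projective_resolution M q -> (n <= q)%N.

(* [pi] exhibits [M] as the [A]-module [A/I]. *)
Definition is_quotient_map (I : A -> Prop) (M : lmodType A)
    (pi : {linear A^o -> M}) : Prop :=
  (forall y, exists x, pi x = y) /\ (forall x, pi x = 0 <-> I x).

End ProjectiveDimension.

Section GradedResolutions.
Variables (k : fieldType) (n : nat).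
Local Notation S := {mpoly k[n]}.

Definition irrelevant_ideal : S -> Prop :=
  ideal_gen (fun f => exists i : 'I_n, f = 'X_i).

(* [F_i] is the direct sum of the [S(-d)], [d = fshift i a], [a < frank i];
   its elements are row vectors, and [F_(i+1) -> F_i] is
   [u |-> u *m fdiff i]. *)
Record free_complex : Type := FreeComplex {
  frank : nat -> nat;
  fshift : forall i, 'I_(frank i) -> nat;
  fdiff : forall i, 'M[S]_(frank i.+1, frank i)
}.

(* The differentials have degree 0 for the standard grading of [S]. *)
Definition is_graded (F : free_complex) : Prop :=
  forall i (a : 'I_(frank F i.+1)) (b : 'I_(frank F i)),
    fdiff F i a b != 0 ->
    exists2 e, fshift a = (fshift b + e)%N & fdiff F i a b \is e.-homog.

Definition is_minimal (F : free_complex) : Prop :=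
  forall i a b, irrelevant_ideal (fdiff F i a b).

(* [... -> F_2 -> F_1 -> F_0 = S -> S/I -> 0] is exact.  As [frank F 0 = 1],
   the vector [v] in the third clause has a single coordinate. *)
Definition resolves_quotient (I : S -> Prop) (F : free_complex) : Prop :=
  [/\ frank F 0 = 1%N,
      forall b : 'I_(frank F 0), fshift b = 0%N,
      forall v : 'rV[S]_(frank F 0),
        (forall b, I (v 0 b)) <-> exists u, u *m fdiff F 0 = v
    & forall i (v : 'rV[S]_(frank F i.+1)),
        v *m fdiff F i = 0 <-> exists u, u *m fdiff F i.+1 = v].

Definition graded_minimal_free_resolution (I : S -> Prop) (F : free_complex)
  : Prop := [/\ resolves_quotient I F, is_graded F & is_minimal F].

Definition graded_betti (F : free_complex) (i d : nat) : nat :=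
  #|[set a : 'I_(frank F i) | fshift a == d]|.

(* Only the [d] among the shifts of [F_i] contribute to the sum over all [d]
   and to the maximum below. *)
Definition total_betti (F : free_complex) (i : nat) : nat :=
  \sum_(d <- undup (codom (@fshift F i))) graded_betti F i d.

Definition max_shift (F : free_complex) (i : nat) : nat :=
  \max_(d <- codom (@fshift F i) | graded_betti F i d != 0%N) d.

End GradedResolutions.

Section Points.
Variable k : fieldType.

(* [x_0, x_1, y_0, y_1] are the variables 0, 1, 2, 3. *)
Definition xvar (i : 'I_2) : {mpoly k[4]} := 'X_(lshift 2 i).
Definition yvar (i : 'I_2) : {mpoly k[4]} := 'X_(rshift 2 i).

(* Homogeneous coordinates of a point of the projective line.  Proportional
   vectors represent the same point; what follows depends only on the point. *)
Definition P1 := {v : 'rV[k]_2 | v != 0}.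
Definition P1xP1 := (P1 * P1)%type.

(* The form [a_1 z_0 - a_0 z_1] vanishing at [R = [a_0 : a_1]]. *)
Definition form_at (z : 'I_2 -> {mpoly k[4]}) (R : P1) : {mpoly k[4]} :=
  (val R 0 1) *: z 0 - (val R 0 0) *: z 1.

Definition point_ideal (P : P1xP1) : {mpoly k[4]} -> Prop :=
  ideal_gen (fun f => f = form_at xvar P.1 \/ f = form_at yvar P.2).

(* The finite set of points is the set of members of [X]. *)
Definition points_ideal (X : seq P1xP1) : {mpoly k[4]} -> Prop :=
  fun f => forall P, P \in X -> point_ideal P f.

Definition double_points_ideal (X : seq P1xP1) : {mpoly k[4]} -> Prop :=
  fun f => forall P, P \in X -> ideal_mul (point_ideal P) (point_ideal P) f.

Definition is_ACM (X : seq P1xP1) : Prop :=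
  quotient_cohen_macaulay (points_ideal X).

End Points.

(* Main.v *)
(* Over the normalized points [option k] of P^1, a set [X] whose coordinate ring
   has depth at least 2 is a staircase: a row with the largest number of points
   meets every column, and this is inherited after removing such rows.  Grouping
   equal rows and columns gives products [u_0, ..., u_(t-1)] of [x]-forms and
   [v_0, ..., v_(t-1)] of [y]-forms such that [I_X] is generated by the [t+1]
   products [g_a = u_0 .. u_(a-1) v_a .. v_(t-1)], and [I_Z = I_X ^ 2].  The
   relations [u_a g_a = v_a g_(a+1)] resolve [I_X], with syzygy module [E] and
   generator module [G], and [I_X ^ 2] has the minimal free resolution
   [0 -> wedge^2 E -> E (x) G -> Sym^2 G], of ranks [t(t-1)/2], [t(t+1)] and
   [(t+1)(t+2)/2].  Hence [p] is 2 or 3 according to [t = 1] or [t > 1].  As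
   [I_Z] starts in degree at least [2t] and minimal shifts strictly increase,
   [M_j >= 2t + j - 1], which gives the bounds. *)
Require Import Defs.
From Stdlib Require Import ClassicalEpsilon.
From HB Require Import structures.
From mathcomp Require Import all_boot all_order all_algebra.
From mathcomp Require Import mpoly.
From mathcomp Require Import ring zify.

Set Implicit Arguments.
Unset Strict Implicit.
Unset Printing Implicit Defensive.

Import Order.TTheory GRing.Theory Num.Theory.
Local Open Scope ring_scope.

(** * Nonzerodivisors modulo an ideal *)

Section NonZeroDivisors.
Variable A : comNzRingType.
Implicit Types (J : A -> Prop) (a b c f g h s : A).

(** The obstacle is the inclusion of I_Z in I_X^2, since symbolic and ordinary squares of an ideal
    differ in general. It is proved block by block: if I' is the ideal of the staircase that remains
    after the block (u, v), and B is v times its first generator, then I_X = (B) + u I', and the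
    crux is that B h in I'^2 + (u) forces h in I' + (u). Here Cohen-Macaulayness enters again, for
    every tail of the staircase, in the form that v is a nonzerodivisor modulo I' + (u).

    All the geometry is phrased through such nonzerodivisors. The hypothesis on X is applied at the
    irrelevant maximal ideal, where a chain of primes of length 2 forces depth at least 2; a regular
    pair found there is then exchanged for linear forms that vanish at no point of X. These exist
    because characteristic zero makes k infinite.

    The given resolution is compared with the explicit one through ranks, which minimality
    determines; degrees are bounded on the given one. *)

Lemma is_idealD J a b : is_ideal J -> J a -> J b -> J (a + b).
Proof. by case=> _ + _; apply. Qed.

Lemma is_idealMl J a b : is_ideal J -> J b -> J (a * b).
Proof. by case=> _ _; apply. Qed.

Lemma is_idealMr J a b : is_ideal J -> J b -> J (b * a).
Proof. by rewrite mulrC; apply: is_idealMl. Qed.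

Lemma is_idealN J a : is_ideal J -> J a -> J (- a).
Proof. by rewrite -mulN1r; apply: is_idealMl. Qed.

Lemma is_idealB J a b : is_ideal J -> J a -> J b -> J (a - b).
Proof. by move=> idJ Ja Jb; apply: is_idealD => //; apply: is_idealN. Qed.

Lemma is_ideal0 J : is_ideal J -> J 0. Proof. by case. Qed.

Lemma is_ideal_sum J (I : Type) (r : seq I) (P : pred I) (F : I -> A) :
  is_ideal J -> (forall i, P i -> J (F i)) -> J (\sum_(i <- r | P i) F i).
Proof. by move=> idJ JF; apply: big_ind => //; [apply: is_ideal0|move=> *; apply: is_idealD]. Qed.

Definition zero_ideal : A -> Prop := eq^~ 0.

Lemma is_ideal_zero : is_ideal zero_ideal.
Proof. by split=> // [a b -> ->|a b ->]; rewrite /zero_ideal (addr0, mulr0). Qed.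

Definition adj J a : A -> Prop := fun f => exists j c, J j /\ f = j + c * a.

Lemma is_ideal_adj J a : is_ideal J -> is_ideal (adj J a).
Proof.
move=> idJ; split=> [|f g [j [c [Jj ->]]] [j' [c' [Jj' ->]]]|f g [j [c [Jj ->]]]].
- by exists 0, 0; split; [apply: is_ideal0|ring].
- by exists (j + j'), (c + c'); split; [apply: is_idealD|ring].
- by exists (f * j), (f * c); split; [apply: is_idealMl|ring].
Qed.

Lemma sub_adj J a f : J f -> adj J a f.
Proof. by move=> Jf; exists f, 0; split=> //; ring. Qed.

Lemma adj_gen J a c : is_ideal J -> adj J a (c * a).
Proof. by move=> idJ; exists 0, c; split; [apply: is_ideal0|ring]. Qed.

Lemma adj_mono (J K : A -> Prop) a f :
  (forall g, J g -> K g) -> adj J a f -> adj K a f.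
Proof. by move=> JK [j [c [Jj ->]]]; exists j, c; split=> //; apply: JK. Qed.

Lemma adjC J a b f : adj (adj J a) b f -> adj (adj J b) a f.
Proof.
move=> [_ [d [[j [c [Jj ->]]] ->]]]; exists (j + d * b), c; split; last by ring.
by exists j, d.
Qed.

Definition nzd J f : Prop := forall g, J (f * g) -> J g.

Lemma nzd1 J : nzd J 1. Proof. by move=> g; rewrite mul1r. Qed.

Lemma nzdM J f g : nzd J f -> nzd J g -> nzd J (f * g).
Proof. by move=> nf ng h; rewrite -mulrA => /nf /ng. Qed.

Lemma nzdX J f n : nzd J f -> nzd J (f ^+ n).
Proof.
by move=> nf; elim: n => [|n IH]; rewrite ?expr0 ?exprS; [apply: nzd1|apply: nzdM].
Qed.

Lemma nzd_prod J (I : eqType) (r : seq I) (F : I -> A) :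
  (forall i, i \in r -> nzd J (F i)) -> nzd J (\prod_(i <- r) F i).
Proof.
elim: r => [|i r IH] nF; first by rewrite big_nil; apply: nzd1.
rewrite big_cons; apply: nzdM; first by apply: nF; rewrite mem_head.
by apply: IH => j jr; apply: nF; rewrite in_cons jr orbT.
Qed.

Lemma nzd_adj1 J f : is_ideal J -> nzd (adj J 1) f.
Proof. by move=> idJ g _; rewrite -[g]mulr1; apply: adj_gen. Qed.

(** Since [a] is a nonzerodivisor modulo [J], multiplication by [a] makes [A/(J + (a * b))] an
    extension of [A/(J + (a))] by a copy of [A/(J + (b))], and [f] acts injectively on both ends. *)
Lemma nzd_adjM J a b f : is_ideal J ->
  nzd J a -> nzd (adj J a) f -> nzd (adj J b) f -> nzd (adj J (a * b)) f.
Proof.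
move=> idJ na nfa nfb g [i [c [Ji fgE]]].
have /nfa[i' [g' [Ji' gE]]] : adj J a (f * g) by exists i, (c * b); split=> //; rewrite fgE; ring.
have /na Jfg : J (a * (f * g' - c * b)).
  suff -> : a * (f * g' - c * b) = i - f * i' by apply: is_idealB => //; apply: is_idealMl.
  by apply/eqP; rewrite -subr_eq0; apply/eqP; transitivity (f * g - (i + c * (a * b))); [rewrite gE; ring|rewrite fgE; ring].
have /nfb[i'' [e [Ji'' g'E]]] : adj J b (f * g').
  by exists (f * g' - c * b), c; split=> //; ring.
exists (i' + a * i''), e; split; first by apply: is_idealD => //; apply: is_idealMl.
by rewrite gE g'E; ring.
Qed.

Lemma nzd_adjX J a f n : is_ideal J ->
  nzd J a -> nzd (adj J a) f -> nzd (adj J (a ^+ n)) f.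
Proof.
move=> idJ na nf; elim: n => [|n IH]; first exact: nzd_adj1.
by rewrite exprS; apply: nzd_adjM.
Qed.

Lemma nzd_adj_prod J (I : eqType) (r : seq I) (F : I -> A) f : is_ideal J ->
  (forall i, i \in r -> nzd J (F i)) ->
  (forall i, i \in r -> nzd (adj J (F i)) f) ->
  nzd (adj J (\prod_(i <- r) F i)) f.
Proof.
move=> idJ; elim: r => [|i r IH] nF nf; first by rewrite big_nil; apply: nzd_adj1.
rewrite big_cons; apply: nzd_adjM; rewrite ?nf ?nF ?mem_head //.
- by apply: nF; rewrite mem_head.
- by apply: nf; rewrite mem_head.
by apply: IH => j jr; [apply: nF|apply: nf]; rewrite in_cons jr orbT.
Qed.

(** The half of the permutability of a regular pair that holds without a local hypothesis. *)
Lemma nzd_swap J a f : is_ideal J ->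
  nzd J f -> nzd (adj J f) a -> nzd (adj J a) f.
Proof.
move=> idJ nf na h [i [c [Ji fhE]]].
have /na[i' [c' [Ji' cE]]] : adj J f (a * c).
  exists (- i), h; split; first exact: is_idealN.
  by rewrite [h * f]mulrC fhE; ring.
have /nf Jh : J (f * (h - c' * a)).
  suff -> : f * (h - c' * a) = i + a * i' by apply: is_idealD => //; apply: is_idealMl.
  by rewrite mulrBr fhE cE; ring.
by exists (h - c' * a), c'; split=> //; ring.
Qed.

(** * The ideals [(a, b)] and [(a, b)^2] *)

Definition id2 a b : A -> Prop := fun f => exists c d, f = c * a + d * b.
Definition sq2 a b : A -> Prop := fun f =>
  exists c d e, f = c * a ^+ 2 + d * (a * b) + e * b ^+ 2.

Lemma id2E a b f : id2 a b f <-> adj (adj zero_ideal a) b f.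
Proof.
split=> [[c [d ->]]|[_ [d [[_ [c [-> ->]]] ->]]]].
  by exists (c * a), d; split=> //; exists 0, c; split=> //; ring.
by exists c, d; ring.
Qed.

Lemma is_ideal_id2 a b : is_ideal (id2 a b).
Proof.
split=> [|f g [c [d ->]] [c' [d' ->]]|f g [c [d ->]]].
- by exists 0, 0; ring.
- by exists (c + c'), (d + d'); ring.
- by exists (f * c), (f * d); ring.
Qed.

Lemma is_ideal_sq2 a b : is_ideal (sq2 a b).
Proof.
split=> [|f g [c [d [e ->]]] [c' [d' [e' ->]]]|f g [c [d [e ->]]]].
- by exists 0, 0, 0; ring.
- by exists (c + c'), (d + d'), (e + e'); ring.
- by exists (f * c), (f * d), (f * e); ring.
Qed.

Lemma id2C a b f : id2 a b f -> id2 b a f.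
Proof. by move=> [c [d ->]]; exists d, c; ring. Qed.

Lemma sq2C a b f : sq2 a b f -> sq2 b a f.
Proof. by move=> [c [d [e ->]]]; exists e, d, c; ring. Qed.

Lemma id2_inter s a b f : nzd (id2 s b) a ->
  id2 s a f -> id2 s b f -> id2 s (a * b) f.
Proof.
move=> na [c [d ->]] [c' [d' E]].
have /na[m [n dE]] : id2 s b (a * d).
  by exists (c' - c), d'; rewrite mulrBl addrAC -E; ring.
by exists (c + a * m), n; rewrite dE; ring.
Qed.

Definition principal a : A -> Prop := adj zero_ideal a.

Lemma principalP a f : principal a f <-> exists c, f = a * c.
Proof.
split=> [[_ [c [-> ->]]]|[c ->]]; first by exists c; ring.
by exists 0, c; split=> //; ring.
Qed.

Lemma is_ideal_principal a : is_ideal (principal a).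
Proof. exact/is_ideal_adj/is_ideal_zero. Qed.

(** The associated graded ring of the regular pair [s, b] is a polynomial ring in which [s] has
    degree one, so cancelling [s] lowers the order by one. *)
Lemma sq2_cancel s b g : nzd zero_ideal s -> nzd (principal s) b ->
  sq2 s b (s * g) -> id2 s b g.
Proof.
move=> ns nb [c [d [e E]]].
have /(nzdX (n := 2) nb)/principalP[e' eE] : principal s (b ^+ 2 * e).
  apply/principalP; exists (g - c * s - d * b).
  by rewrite !mulrBr E; ring.
exists c, (d + e' * b); apply/eqP; rewrite -subr_eq0; apply/eqP/ns.
by rewrite /zero_ideal mulrBr E eE; ring.
Qed.

(** Compare expansions in powers of [s]: modulo [s] the last coefficient [c3] lies in [(b^2)]. Once
    that part is removed, one factor [s] cancels, which brings the corrected middle coefficient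
    [c2 + d * a] into [(s, b)]. *)
Lemma sq2_inter s a b f : nzd zero_ideal s -> nzd (principal s) b ->
    nzd (id2 s b) a ->
  sq2 s a f -> sq2 s b f -> sq2 s (a * b) f.
Proof.
move=> ns nb na [c1 [c2 [c3 ->]]] [e1 [e2 [e3 E]]].
have na2 : nzd (id2 s (b ^+ 2)) (a ^+ 2).
  move=> g /id2E gI; apply/id2E; move: g gI; apply: nzd_adjX => //.
    exact/is_ideal_adj/is_ideal_zero.
  by move=> g /id2E/(nzdX (n := 2) na)/id2E.
have /na2[d [e c3E]] : id2 s (b ^+ 2) (a ^+ 2 * c3).
  exists (e1 * s + e2 * b - c1 * s - c2 * a), e3.
  by rewrite [LHS]mulrC -(addKr (c1 * s ^+ 2 + c2 * (s * a)) (c3 * _)) E; ring.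
have /(sq2_cancel ns nb)/na[m [n E2]] : sq2 s b (s * (a * (c2 + d * a))).
  exists (e1 - c1), e2, (e3 - e * a ^+ 2).
  have -> : s * (a * (c2 + d * a)) = e1 * s ^+ 2 + e2 * (s * b) + e3 * b ^+ 2
             - c1 * s ^+ 2 - e * b ^+ 2 * a ^+ 2 by rewrite -E c3E; ring.
  ring.
exists (c1 + a * m), n, e.
have -> : c1 * s ^+ 2 + c2 * (s * a) + c3 * a ^+ 2 =
  c1 * s ^+ 2 + (c2 + d * a) * (s * a) + e * b ^+ 2 * a ^+ 2 by rewrite c3E; ring.
by rewrite E2; ring.
Qed.

(** As [s, b] is regular in both orders, [(s, b)/(s, b)^2] is free over [A/(s, b)]; so [a] acts
    injectively on both layers of [A/(s, b)^2]. *)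
Lemma nzd_sq2 s b a : nzd (principal s) b -> nzd (principal b) s ->
    nzd zero_ideal s -> nzd zero_ideal b ->
  nzd (id2 s b) a -> nzd (sq2 s b) a.
Proof.
move=> nb ns ns0 nb0 na g sag.
have /na[m [n gE]] : id2 s b (a * g).
  by case: sag => c [d [e ->]]; exists (c * s + d * b), (e * b); ring.
case: sag => c [d [e E]].
have /ns/principalP[w wE] : principal b (s * (a * m - c * s - d * b)).
  apply/principalP; exists (e * b - a * n).
  have -> : s * (a * m - c * s - d * b) = a * g - a * n * b - c * s ^+ 2 - d * s * b
    by rewrite gE; ring.
  by rewrite E; ring.
have /na[m1 [m2 mE]] : id2 s b (a * m).
  exists c, (d + w).
  rewrite -[LHS](subrK (c * s + d * b)); have -> : a * m - (c * s + d * b) = b * w by rewrite -wE; ring.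
  ring.
have /na[n1 [n2 nE]] : id2 s b (a * n).
  exists (- w), e.
  have /nb0 wE0 : zero_ideal (b * (a * n - (- w * s + e * b))).
    rewrite /zero_ideal.
    have -> : b * (a * n - (- w * s + e * b)) = a * g - s * (a * m) + s * (b * w) - e * b ^+ 2
      by rewrite gE; ring.
    by rewrite -wE E; ring.
  by apply/eqP; rewrite -subr_eq0; apply/eqP.
by exists m1, (m2 + n1), n2; rewrite gE mE nE; ring.
Qed.

Lemma principal_inter a b f : nzd (principal b) a ->
  principal a f -> principal b f -> principal (a * b) f.
Proof.
move=> na /principalP[c ->] /na/principalP[d ->]; apply/principalP.
by exists d; ring.
Qed.

Lemma id2M_sq2 a b f g : id2 a b f -> id2 a b g -> sq2 a b (f * g).
Proof.
move=> [c [d ->]] [c' [d' ->]].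
by exists (c * c'), (c * d' + d * c'), (d * d'); ring.
Qed.

(* Depth at least two does not depend on the choice of the first element of
   the regular sequence. *)
Lemma regular_exchange J f1 f2 l g : is_ideal J ->
    nzd J f1 -> nzd (adj J f1) f2 -> nzd J l ->
  adj J l (f1 * g) -> adj J l (f2 * g) -> adj J l g.
Proof.
move=> idJ n1 n2 nl [i1 [g' [Ji1 E1]]] [i2 [s [Ji2 E2]]].
have /n2[i3 [w [Ji3 g'E]]] : adj J f1 (f2 * g').
  exists (f2 * g' - s * f1), s; split; last by ring.
  apply: nl; have -> : l * (f2 * g' - s * f1) = f1 * i2 - f2 * i1.
    have -> : l * (f2 * g' - s * f1) = f2 * (f1 * g - i1) - f1 * (f2 * g - i2).
      by rewrite E1 E2; ring.
    by ring.
  by apply: is_idealB => //; apply: is_idealMl.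
exists (g - w * l), w; split; last by ring.
apply: n1; have -> : f1 * (g - w * l) = i1 + l * i3 by rewrite mulrBr E1 g'E; ring.
by apply: is_idealD => //; apply: is_idealMl.
Qed.

End NonZeroDivisors.

Lemma nzd_field (B : idomainType) (f : B) : f != 0 -> nzd (@zero_ideal B) f.
Proof. by move=> f0 g /eqP; rewrite mulf_eq0 (negPf f0) => /eqP. Qed.

(** * The square of a staircase ideal and its resolution *)

Section Staircase.
Variable A : idomainType.
Implicit Types (w : seq (A * A)) (u v f g h : A).

(* [w] lists the pairs [(u_a, v_a)]; [scol w] is [g_0 = v_0 .. v_(t-1)], [sI w]
   is [(g_0, ..., g_t)] and [sJ w] its square. *)
Fixpoint scol w : A := if w is x :: w' then x.2 * scol w' else 1.

Fixpoint sI w : A -> Prop :=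
  if w is x :: w' then
    fun f => exists c i, sI w' i /\ f = c * (x.2 * scol w') + x.1 * i
  else fun=> True.

Fixpoint sJ w : A -> Prop :=
  if w is x :: w' then fun f => exists c i j, [/\ sI w' i, sJ w' j &
    f = c * (x.2 * scol w') ^+ 2 + x.1 * (x.2 * scol w') * i + x.1 ^+ 2 * j]
  else fun=> True.

Lemma is_ideal_sI w : is_ideal (sI w).
Proof.
elim: w => [|[u v] w IH] //; split=> /=.
- by exists 0, 0; split; [apply: is_ideal0|ring].
- move=> _ _ [c [i [Ii ->]]] [c' [i' [Ii' ->]]]; exists (c + c'), (i + i').
  by split; [apply: is_idealD|ring].
- move=> f _ [c [i [Ii ->]]]; exists (f * c), (f * i).
  by split; [apply: is_idealMl|ring].
Qed.

Lemma is_ideal_sJ w : is_ideal (sJ w).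
Proof.
elim: w => [|[u v] w IH] //; split=> /=.
- by exists 0, 0, 0; split; [exact: (is_ideal0 (is_ideal_sI _))|exact: is_ideal0|ring].
- move=> _ _ [c [i [j [Ii Jj ->]]]] [c' [i' [j' [Ii' Jj' ->]]]].
  exists (c + c'), (i + i'), (j + j').
  by split; [apply: is_idealD => //; apply: is_ideal_sI|apply: is_idealD|ring].
- move=> f _ [c [i [j [Ii Jj ->]]]]; exists (f * c), (f * i), (f * j).
  by split; [apply: is_idealMl => //; apply: is_ideal_sI|apply: is_idealMl|ring].
Qed.

Lemma scol_sJ w f : sI w f -> sJ w (scol w * f).
Proof.
case: w => [|[u v] w] //= [c [i [Ii ->]]]; exists c, i, 0.
by split=> //; [exact: (is_ideal0 (is_ideal_sJ _))|ring].
Qed.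

(* What the induction on [w] in [sJ_colon] needs to know about the block [(u, v)]
   preceding [w]. *)
Fixpoint colon_ok w u v : Prop :=
  if w is x :: w' then
    [/\ nzd (principal u) x.1, nzd (id2 u x.1) (x.2 * scol w'),
        nzd (adj (sI w) u) v & colon_ok w' u x.2]
  else True.

(** Cancelling [B] modulo [(u, u1^2)] writes [v * h] as [k * u1 ^+ 2] up to [sI] and [u], and then
    [B * k] lies in the square of the tail modulo [u]. The induction keeps [u] and replaces [v] by
    [v1], so [k] is in the tail ideal modulo [u]; finally [v] is cancelled by the third condition of
    [colon_ok]. *)
Lemma sJ_colon w u v h : colon_ok w u v ->
  adj (sJ w) u (v * scol w * h) -> adj (sI w) u h.
Proof.
elim: w v h => [|[u1 v1] w IH] v h.
  by move=> _ _; apply: sub_adj.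
move=> /= [nu1 nB nv ok] [_ [m [[c [i [j [Ii Jj ->]]]] E]]].
set B := v1 * scol w in nB nv E.
have {}E : B * (v * h) = c * B ^+ 2 + u1 * B * i + u1 ^+ 2 * j + m * u.
  by rewrite -E; ring.
have {}nB : nzd (id2 u (u1 ^+ 2)) B.
  move=> g /id2E gI; apply/id2E; move: g gI.
  apply: nzd_adjX => //; first exact: is_ideal_principal.
  by move=> g /id2E/nB/id2E.
have /nB[a [k kE]] : id2 u (u1 ^+ 2) (B * (v * h - c * B - u1 * i)).
  by exists m, j; rewrite !mulrBr E; ring.
have /(nzdX (n := 2) nu1)/principalP[e eE] : principal u (u1 ^+ 2 * (B * k - j)).
  apply/principalP; exists (m - B * a).
  have -> : u1 ^+ 2 * (B * k - j) = B * (k * u1 ^+ 2) - u1 ^+ 2 * j by ring.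
  have -> : k * u1 ^+ 2 = v * h - c * B - u1 * i - a * u by rewrite kE; ring.
  by rewrite !mulrBr E; ring.
have [|i' [d [Ii' kE']]] := IH _ k ok.
  by exists j, e; split=> //; rewrite [e * u]mulrC -eE /B; ring.
apply: nv; exists (c * B + u1 * (i + u1 * i')), (a + u1 ^+ 2 * d); split.
  exists c, (i + u1 * i'); split=> //; apply: is_idealD => //; first exact: is_ideal_sI.
  by apply: is_idealMl => //; apply: is_ideal_sI.
have -> : v * h = a * u + k * u1 ^+ 2 + c * B + u1 * i by rewrite -kE; ring.
by rewrite kE'; ring.
Qed.

(** The coefficients [f] and [g] are not unique: a part [d * u] of [f] may be moved into [g] as
    [B * d]. [sJ_colon] finds the [d] that leaves the tail ideal in the middle term, and cancelling
    [u] then puts [B * d + g] in the square of the tail. *)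
Lemma sJ_cons w u v c f g : colon_ok w u v -> nzd (sJ w) u ->
  let B := v * scol w in sJ w (B * f + u * g) ->
  sJ ((u, v) :: w) (c * B ^+ 2 + u * B * f + u ^+ 2 * g).
Proof.
move=> ok nu B JBf; have idJ := is_ideal_sJ w.
have [|i [d [Ii fE]]] := @sJ_colon w u v f ok.
  by exists (B * f + u * g), (- g); split=> //; rewrite /B; ring.
exists c, i, (B * d + g); split=> //; last by rewrite fE /= -/B; ring.
apply: nu; have -> : u * (B * d + g) = (B * f + u * g) - v * (scol w * i).
  by rewrite fE /B; ring.
by apply: is_idealB => //; apply: is_idealMl => //; apply: scol_sJ.
Qed.

(* Matrices act on row vectors.  With [e_0 .. e_t] the basis of [G] and
   [f_0 .. f_(t-1)] that of [E], the recursive block structure lists the bases as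
   [e_0 e_0], [e_0 e_b], then [Sym^2] of the tail; [f_0 e_0], [f_0 e_c],
   [f_s e_0], then the tail; [f_0 f_s], then the tail, where [b, c, s >= 1].
   [mumx] and [numx] are multiplication by [e_0] on [G] and on [E]. *)
Fixpoint gmx w : 'cV[A]_(size w).+1 :=
  if w is x :: w' then
    col_mx (x.2 * scol w')%:M (x.1 *: gmx w') : 'cV_(1 + (size w').+1)
  else 1%:M.

Fixpoint hmx w : 'M[A]_(size w, (size w).+1) :=
  if w is x :: w' then
    block_mx x.1%:M (- x.2 *: delta_mx 0 0) 0 (hmx w')
      : 'M_(1 + size w', 1 + (size w').+1)
  else 0.

Fixpoint rk1 n := if n is n'.+1 then (1 + (n'.+1 + rk1 n'))%N else 1%N.
Fixpoint rk2 n := if n is n'.+1 then (1 + (n'.+1 + (n' + rk2 n')))%N else 0%N.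
Fixpoint rk3 n := if n is n'.+1 then (n' + rk3 n')%N else 0%N.

Fixpoint e1mx w : 'cV[A]_(rk1 (size w)) :=
  if w is x :: w' then
    col_mx ((x.2 * scol w') ^+ 2)%:M
      (col_mx (x.1 * (x.2 * scol w') *: gmx w') (x.1 ^+ 2 *: e1mx w'))
  else 1%:M.

Definition mumx w : 'M[A]_((size w).+1, rk1 (size w)) :=
  if w is x :: w' then
    block_mx 1%:M 0 0 (row_mx 1%:M 0)
      : 'M_(1 + (size w').+1, 1 + ((size w').+1 + rk1 (size w')))
  else 1%:M.

(** The rows of blocks are the images of [f_0 e_0], [f_0 e_c], [f_s e_0] and of the tail under
    [f e |-> d(f) e], where [d(f_0) = u e_0 - v e_1]; multiplication by [e_1] is [mumx] of the
    tail. *)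
Fixpoint e2mx w : 'M[A]_(rk2 (size w), rk1 (size w)) :=
  if w is x :: w' then
    col_mx (row_mx x.1%:M (row_mx (- x.2 *: delta_mx 0 0) 0))
   (col_mx (row_mx 0 (row_mx x.1%:M (- x.2 *: mumx w')))
   (col_mx (row_mx 0 (row_mx (hmx w') 0))
           (row_mx 0 (row_mx 0 (e2mx w')))))
  else 0.

Definition numx w : 'M[A]_(size w, rk2 (size w)) :=
  if w is x :: w' then
    block_mx 1%:M 0 0 (row_mx 0 (row_mx 1%:M 0))
      : 'M_(1 + size w', 1 + ((size w').+1 + (size w' + rk2 (size w'))))
  else 0.

(** The Koszul-type map [f_0 ^ f_s |-> f_0 d(f_s) - f_s d(f_0)], with [numx] of the tail as
    multiplication by [e_1]. *)
Fixpoint e3mx w : 'M[A]_(rk3 (size w), rk2 (size w)) :=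
  if w is x :: w' then
    col_mx (row_mx 0 (row_mx (hmx w') (row_mx (- x.1%:M) (x.2 *: numx w'))))
           (row_mx 0 (row_mx 0 (row_mx 0 (e3mx w'))))
  else 0.

Lemma gmx_row0 w : delta_mx 0 0 *m gmx w = (scol w)%:M :> 'M_1.
Proof.
rewrite -rowE; apply/rowP => i; rewrite !ord1 !mxE.
case: w => [|[u v] w] /=; rewrite ?mxE ?eqxx //.
by case: splitP => j //; rewrite !mxE !ord1 eqxx.
Qed.

Lemma hmx_gmx w : hmx w *m gmx w = 0.
Proof.
elim: w => [|[u v] w IH] /=; first by rewrite mul0mx.
rewrite (@mul_block_col _ 1 _ 1) mul0mx add0r -!scalemxAr IH scaler0.
rewrite -scalemxAl gmx_row0 -scalar_mxM -!scale_scalar_mx.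
rewrite [X in col_mx X _](_ : _ = 0) ?col_mx0 //.
by apply/rowP => i; rewrite !mxE; ring.
Qed.

Lemma mumx_e1mx w : mumx w *m e1mx w = scol w *: gmx w.
Proof.
case: w => [|[u v] w] /=; first by rewrite mul1mx scale1r.
rewrite (@mul_block_col _ 1 _ 1) !mul1mx !mul0mx addr0 add0r mul_row_col mul1mx mul0mx addr0.
apply/esym/(etrans (scale_col_mx (_ : A) (_ : 'M_(1, 1)) (_ : 'M_((size w).+1, 1)))).
by rewrite scale_scalar_mx scalerA [_ * u]mulrC.
Qed.

Lemma e2mx_e1mx w : e2mx w *m e1mx w = 0.
Proof.
elim: w => [|[u v] w IH] /=; first by rewrite mul0mx.
rewrite !mul_col_mx !mul_row_col !mul0mx !add0r !addr0 -!scalemxAr IH hmx_gmx.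
rewrite -!scalemxAl mumx_e1mx gmx_row0 !scaler0 !mul_scalar_mx.
set x := (X in col_mx X _); set y := (X in col_mx _ (col_mx X _)).
have -> : x = 0 by apply/rowP => i; rewrite !mxE; ring.
have -> : y = 0 by apply/colP => i; rewrite !mxE; ring.
by rewrite !col_mx0.
Qed.

Lemma numx_e2mx w : numx w *m e2mx w = hmx w *m mumx w.
Proof.
case: w => [|[u v] w] /=; first by rewrite !mul0mx.
rewrite (@mul_block_col _ 1 _ 1) !mul_row_col !mul1mx !mul0mx !addr0 !add0r.
rewrite (@mulmx_block _ 1 _ 1) !mulmx1 !mulmx0 ?mul0mx !addr0 ?add0r.
by rewrite !mul_mx_row !mulmx1 !mulmx0 /block_mx.
Qed.

Lemma e3mx_e2mx w : e3mx w *m e2mx w = 0.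
Proof.
elim: w => [|[u v] w IH] /=; first by rewrite mul0mx.
rewrite !mul_col_mx !mul_row_col !mul0mx !add0r !mul_mx_row IH !mulmx0 !row_mx0.
rewrite -!scalemxAl numx_e2mx -!scalemxAr mulNmx mul_scalar_mx mul_mx_scalar.
rewrite !add_row_mx !add0r addr0 subrr -scalerDl addNr scale0r.
by rewrite !row_mx0 col_mx0.
Qed.

(** These are the cancellations behind exactness: the second condition cancels [B] modulo [u], the
    third cancels [u] modulo the tail ideal, the fourth makes [hmx] of the tail injective modulo
    [u]. *)
Fixpoint stair_ok w : Prop :=
  if w is x :: w' then
    [/\ x.1 != 0, nzd (principal x.1) (x.2 * scol w'), nzd (sI w') x.1,
        (forall y, y \in w' -> nzd (principal x.1) y.1) & stair_ok w']
  else True.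

Lemma row1P n (c : 'rV[A]_(1 + n)) : exists a b, c = row_mx a%:M b.
Proof.
by exists (lsubmx c 0 0), (rsubmx c); rewrite -mx11_scalar hsubmxK.
Qed.

Lemma rowP2 m n (c : 'rV[A]_(m + n)) : exists a b, c = row_mx a b.
Proof. by exists (lsubmx c), (rsubmx c); rewrite hsubmxK. Qed.

Lemma scalar11_inj : injective (fun a : A => a%:M : 'M_1).
Proof. by move=> a b /matrixP/(_ 0 0); rewrite !mxE eqxx. Qed.

Lemma sI_gmx w f : sI w f <-> exists c, c *m gmx w = f%:M.
Proof.
elim: w f => [|[u v] w IH] f /=.
  by split=> // _; exists f%:M; rewrite mulmx1.
split=> [[a [i [/IH[c cE] ->]]]|[c cE]].
  exists (row_mx a%:M c : 'rV_(1 + _)).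
  by rewrite (@mul_row_col _ _ 1) -scalemxAr cE scale_scalar_mx -scalar_mxM -raddfD.
have [a [b abE]] := row1P c; move: cE; rewrite abE (@mul_row_col _ _ 1) -scalemxAr.
rewrite [b *m _]mx11_scalar scale_scalar_mx -scalar_mxM -raddfD => /scalar11_inj <-.
exists a, ((b *m gmx w) 0 0); split=> //; apply/IH; exists b; exact: mx11_scalar.
Qed.

Lemma sJ_e1mx w f : sJ w f <-> exists c, c *m e1mx w = f%:M.
Proof.
elim: w f => [|[u v] w IH] f /=.
  by split=> // _; exists f%:M; rewrite mulmx1.
split=> [[a [i [j [/sI_gmx[b bE] /IH[c cE] ->]]]]|[c cE]].
  exists (row_mx a%:M (row_mx b c)).
  by rewrite !mul_row_col -!scalemxAr cE bE !scale_scalar_mx -scalar_mxM -!raddfD addrA.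
have [a [b0 abE]] := row1P c; have [b [d bdE]] := rowP2 b0; subst c b0.
move: cE; rewrite !mul_row_col -!scalemxAr.
rewrite [b *m _]mx11_scalar [d *m _]mx11_scalar !scale_scalar_mx -scalar_mxM -!raddfD.
move=> /scalar11_inj <-.
exists a, ((b *m gmx w) 0 0), ((d *m e1mx w) 0 0); split.
- by apply/sI_gmx; exists b; exact: mx11_scalar.
- by apply/IH; exists d; exact: mx11_scalar.
- by rewrite addrA.
Qed.

(** The relation shows that [u] divides [B * a], hence [a]. Subtracting that multiple of the first
    row leaves [u] times a relation of the tail. *)
Lemma hmx_exact w (c : 'rV_(size w).+1) : stair_ok w ->
  c *m gmx w = 0 -> exists b, b *m hmx w = c.
Proof.
elim: w c => [|[u v] w IH] c /=.
  by move=> _; rewrite mulmx1 => ->; exists 0; rewrite mulmx0.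
move=> [u0 nB _ _ ok]; have [a [c' ->]] := row1P c; rewrite (@mul_row_col _ _ 1).
rewrite -scalemxAr -scalar_mxM => E.
have /nB/principalP[d dE] : principal u (v * scol w * a).
  apply/principalP; exists (- (c' *m gmx w) 0 0).
  move/matrixP/(_ 0 0): E; rewrite !mxE eqxx mulr1n => /eqP.
  by rewrite addr_eq0 => /eqP; rewrite mulrC => ->; rewrite mulrN.
have [|b bE] := IH (c' + d * v *: delta_mx 0 0) ok.
  apply: (scalemx_inj u0); rewrite scaler0 -E addrC mulmxDl scalerDr; congr (_ + _).
  by rewrite -!scalemxAl gmx_row0 !scale_scalar_mx dE; congr _%:M; ring.
exists (row_mx d%:M b : 'rV_(1 + _)).
rewrite (@mul_row_block _ _ 1 _ 1) mulmx0 addr0 bE -scalar_mxM -scalemxAr mul_scalar_mx.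
by rewrite dE mulrC scalerA addrC mulNr scaleNr [v * d]mulrC addrK.
Qed.

(** The four coefficients are found in the order of the basis: [d] by dividing [a] by [u], then [e]
    because the quotient [m] of the corrected [x] by [u] lies in the tail ideal, then [s] from the
    syzygies of the tail, and [r] by induction. *)
Lemma e2mx_exact w (c : 'rV_(rk1 (size w))) : stair_ok w ->
  c *m e1mx w = 0 -> exists b, b *m e2mx w = c.
Proof.
elim: w c => [|[u v] w IH] c /=.
  by move=> _; rewrite mulmx1 => ->; exists 0; rewrite mulmx0.
move=> [u0 nB nI _ ok]; have [a [b0 ->]] := row1P c; have [b [c' ->]] := rowP2 b0.
set B := v * scol w in nB *.
rewrite !mul_row_col -!scalemxAr [b *m _]mx11_scalar [c' *m _]mx11_scalar.
rewrite !scale_scalar_mx -scalar_mxM -!raddfD -(raddf0 (@scalar_mx A 1)).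
move=> /scalar11_inj; set x := (b *m _) 0 0; set y := (c' *m _) 0 0 => E.
have /nB/nB/principalP[d dE] : principal u (B * (B * a)).
  apply/principalP; exists (- (B * x + u * y)).
  apply/eqP; rewrite -subr_eq0 -[X in _ == X]E; apply/eqP; ring.
have /(mulfI u0) {}E : u * (B * (x + d * v * scol w) + u * y) = u * 0.
  by rewrite mulr0 -[RHS]E dE /B; ring.
have /nB/principalP[m mE] : principal u (B * (x + d * v * scol w)).
  by apply/principalP; exists (- y); rewrite mulrN; apply/eqP; rewrite -addr_eq0 E.
have /sI_gmx[e eE] : sI w m.
  apply: nI; rewrite -mE; apply/sI_gmx; exists (b + d * v *: delta_mx 0 0).
  by rewrite mulmxDl -scalemxAl gmx_row0 [b *m _]mx11_scalar scale_scalar_mx raddfD.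
have [|s sE] := @hmx_exact w (b + d * v *: delta_mx 0 0 - u *: e) ok.
  rewrite mulmxBl mulmxDl -!scalemxAl gmx_row0 eE [b *m _]mx11_scalar -/x.
  by rewrite !scale_scalar_mx -raddfD -raddfB /= mE subrr raddf0.
have [|r rE] := IH (c' + v *: (e *m mumx w)) ok.
  rewrite mulmxDl -scalemxAl -mulmxA mumx_e1mx -scalemxAr eE [c' *m _]mx11_scalar -/y.
  rewrite !scale_scalar_mx -raddfD -(raddf0 (@scalar_mx A 1)); congr _%:M.
  by apply: (mulfI u0); rewrite mulr0 -[RHS]E mE /B; ring.
exists (row_mx d%:M (row_mx e (row_mx s r))).
rewrite !mul_row_col !mul_mx_row !mulmx0 !add_row_mx !add0r !addr0 sE rE.
rewrite -scalar_mxM [d * u]mulrC -dE -!scalemxAr mul_mx_scalar mul_scalar_mx.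
congr (row_mx _ (row_mx _ _)); last by rewrite scaleNr addrC addrK.
by apply/rowP => i; rewrite !mxE; ring.
Qed.

(** [hmx] is triangular with the entries [y.1] on its diagonal, all nonzerodivisors modulo [u]. *)
Lemma hmx_mod w u (b : 'rV_(size w)) (c : 'rV_(size w).+1) :
  (forall y, y \in w -> nzd (principal u) y.1) ->
  b *m hmx w = u *: c -> exists b', b = u *: b'.
Proof.
elim: w b c => [|[u1 v1] w IH] b c nu /=.
  by move=> _; exists 0; apply/rowP => -[].
have [a [b' ->]] := row1P b; have [c0 [c' ->]] := row1P c.
rewrite (@mul_row_block _ _ 1 _ 1) mulmx0 addr0 (scale_row_mx _ (_ : 'M_(1, 1))).
move/(@eq_row_mx _ 1 1) => []; rewrite -scalar_mxM scale_scalar_mx.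
move=> /scalar11_inj aE E.
have /(nu (u1, v1) (mem_head _ _))/principalP[a' aE'] : principal u (u1 * a).
  by apply/principalP; exists c0; rewrite mulrC.
subst a.
have [||b1 ->] := IH b' (c' + v1 * a' *: delta_mx 0 0).
- by move=> y yw; apply: nu; rewrite in_cons yw orbT.
- rewrite scalerDr -E -scalemxAr mul_scalar_mx !scalerA mulNr scaleNr addrAC.
  by rewrite [v1 * (u * a')]mulrCA addNr add0r.
exists (row_mx a'%:M b1 : 'rV_(1 + _)).
by rewrite (scale_row_mx _ (_ : 'M_(1, 1))) scale_scalar_mx.
Qed.

(** The coordinate at [f_0 e_0] vanishes because [u != 0]. The next block then says that
    [s *m hmx w] is divisible by [u], hence so is [s], and the quotient [s'] gives the coefficients
    of the [f_0 ^ f_s] up to sign. *)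
Lemma e3mx_exact w (c : 'rV_(rk2 (size w))) : stair_ok w ->
  c *m e2mx w = 0 -> exists b, b *m e3mx w = c.
Proof.
elim: w c => [|[u v] w IH] c /=.
  by move=> _ _; exists 0; apply/rowP => -[].
move=> [u0 nB _ nu ok]; have [a [b0 ->]] := row1P c; have [b [c0 ->]] := rowP2 b0.
have [s [r ->]] := rowP2 c0.
rewrite !mul_row_col !mul_mx_row !mulmx0 !add_row_mx !add0r !addr0.
rewrite -row_mx0 => /eq_row_mx[]; rewrite -scalar_mxM -(raddf0 (@scalar_mx A 1)).
move=> /scalar11_inj/eqP; rewrite mulf_eq0 (negPf u0) orbF => /eqP ->.
rewrite raddf0 mul0mx add0r -row_mx0 => /eq_row_mx[E1 E2].
have [|s' sE] := @hmx_mod w u s (- b) nu.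
  by apply/eqP; rewrite scalerN -addr_eq0 addrC -mul_mx_scalar E1.
have bE : b = - (s' *m hmx w).
  apply/eqP; rewrite -addr_eq0; apply/eqP/(scalemx_inj u0).
  by rewrite scaler0 scalerDr scalemxAl -sE -mul_mx_scalar.
have [|q qE] := IH (r + v *: (s' *m numx w)) ok.
  rewrite mulmxDl -scalemxAl -mulmxA numx_e2mx mulmxA -E2 bE.
  by rewrite -scalemxAr mulNmx scaleNr scalerN opprK addrC.
exists (row_mx (- s') q).
rewrite mul_row_col !mul_mx_row !mulmx0 !add_row_mx !add0r !addr0 qE mulNmx -bE.
rewrite mulmxN mulNmx opprK mul_mx_scalar -sE -scalemxAr mulNmx scalerN.
by rewrite addrC addrK.
Qed.

Lemma e3mx_inj w (c : 'rV_(rk3 (size w))) : stair_ok w ->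
  c *m e3mx w = 0 -> c = 0.
Proof.
elim: w c => [|[u v] w IH] c /=; first by move=> _ _; apply/rowP => -[].
move=> [u0 _ _ _ ok]; have [s [q ->]] := rowP2 c.
rewrite mul_row_col !mul_mx_row !mulmx0 !add_row_mx !add0r !addr0.
rewrite -!row_mx0 => /eq_row_mx[_ /eq_row_mx[_ /eq_row_mx[]]].
rewrite mulmxN mul_mx_scalar => /eqP; rewrite oppr_eq0 scalemx_eq0 (negPf u0) /=.
by move=> /eqP ->; rewrite mul0mx add0r => /(IH _ ok) ->.
Qed.

(** * Entries of the differentials in a given ideal *)

Definition mx_in (J : A -> Prop) m n (M : 'M[A]_(m, n)) := forall i j, J (M i j).

Lemma row_mx_in J m n1 n2 (M : 'M_(m, n1)) (N : 'M_(m, n2)) :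
  mx_in J M -> mx_in J N -> mx_in J (row_mx M N).
Proof. by move=> JM JN i j; rewrite mxE; case: splitP => *; [apply: JM|apply: JN]. Qed.

Lemma col_mx_in J m1 m2 n (M : 'M_(m1, n)) (N : 'M_(m2, n)) :
  mx_in J M -> mx_in J N -> mx_in J (col_mx M N).
Proof. by move=> JM JN i j; rewrite mxE; case: splitP => *; [apply: JM|apply: JN]. Qed.

Lemma scale_mx_in J m n a (M : 'M_(m, n)) : is_ideal J -> J a -> mx_in J (a *: M).
Proof. by move=> idJ Ja i j; rewrite mxE; apply: is_idealMr. Qed.

Lemma scalar_mx_in J n a : is_ideal J -> J a -> mx_in J (a%:M : 'M_n).
Proof.
by move=> idJ Ja i j; rewrite mxE; case: (_ == _) => //; rewrite mulr0n; apply: is_ideal0.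
Qed.

Lemma mx_in0 J m n : is_ideal J -> mx_in J (0 : 'M_(m, n)).
Proof. by move=> idJ i j; rewrite mxE; apply: is_ideal0. Qed.

Section Minimality.
Variable J : A -> Prop.
Hypothesis idJ : is_ideal J.
Let Jw w := forall x, x \in w -> J x.1 /\ J x.2.

Lemma hmx_in w : Jw w -> mx_in J (hmx w).
Proof.
elim: w => [|[u v] w IH] Jw0 /=; first exact: mx_in0.
have [Ju Jv] := Jw0 _ (mem_head _ _).
have JN := is_idealN idJ Jv.
apply: (@col_mx_in J 1); apply: (@row_mx_in J _ 1).
- exact: scalar_mx_in.
- exact: scale_mx_in.
- exact: mx_in0.
- by apply: IH => y yw; apply: Jw0; rewrite in_cons yw orbT.
Qed.

Lemma e1mx_in w : Jw w -> (0 < size w)%N -> mx_in J (e1mx w).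
Proof.
case: w => [|[u v] w] // /(_ _ (mem_head _ _))[Ju Jv] _ /=.
apply: col_mx_in; [|apply: col_mx_in].
- by apply: scalar_mx_in => //; rewrite exprS; do 2!apply: is_idealMr => //.
- by apply: scale_mx_in => //; apply: is_idealMr.
- by apply: scale_mx_in => //; rewrite exprS; apply: is_idealMr.
Qed.

Lemma e2mx_in w : Jw w -> mx_in J (e2mx w).
Proof.
elim: w => [|[u v] w IH] Jw0 /=; first exact: mx_in0.
have [Ju Jv] := Jw0 _ (mem_head _ _).
have JN := is_idealN idJ Jv.
have Jw' : Jw w by move=> y yw; apply: Jw0; rewrite in_cons yw orbT.
by do ![apply: col_mx_in|apply: row_mx_in|exact: mx_in0|exact: scalar_mx_in
  |exact: scale_mx_in|exact: hmx_in|exact: IH].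
Qed.

Lemma e3mx_in w : Jw w -> mx_in J (e3mx w).
Proof.
elim: w => [|[u v] w IH] Jw0 /=; first exact: mx_in0.
have [Ju Jv] := Jw0 _ (mem_head _ _).
have JN := is_idealN idJ Ju.
have Jw' : Jw w by move=> y yw; apply: Jw0; rewrite in_cons yw orbT.
have -> : - u%:M = (- u)%:M :> 'M_(size w) by rewrite raddfN.
by do ![apply: col_mx_in|apply: row_mx_in|exact: mx_in0|exact: scalar_mx_in
  |exact: scale_mx_in|exact: hmx_in|exact: IH].
Qed.

End Minimality.

Lemma rk1E n : (rk1 n * 2 = n.+1 * n.+2)%N.
Proof. by elim: n => //= n IH; nia. Qed.

Lemma rk3E n : (rk3 n * 2 = n * n.-1)%N.
Proof. by elim: n => //= n IH; nia. Qed.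

Lemma rk2E n : (rk2 n = n * n.+1)%N.
Proof. by elim: n => //= n IH; nia. Qed.

End Staircase.

(** * Comparison of projective resolutions *)

Section ImageModule.
Variables (A : comNzRingType) (M N : lmodType A) (g : {linear M -> N}).

(** Submodules are built on boolean predicates, so membership in the image is decided
    classically. *)
Definition image_pred : {pred N} :=
  fun y => if excluded_middle_informative (exists x, g x = y) then true else false.

Lemma image_predP y : reflect (exists x, g x = y) (y \in image_pred).
Proof.
by rewrite unfold_in /image_pred; case: excluded_middle_informative; constructor.
Qed.

Lemma image_submod_closed : submod_closed image_pred.
Proof.
split=> [|a y z /image_predP[x <-] /image_predP[x' <-]]; apply/image_predP.
  by exists 0; rewrite linear0.
by exists (a *: x + x'); rewrite linearP.
Qed.

HB.instance Definition _ := GRing.isSubmodClosed.Build A N image_pred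
  image_submod_closed.

Definition image_mod : Type := {y | y \in image_pred}.
HB.instance Definition _ := SubChoice.on image_mod.
HB.instance Definition _ := [SubChoice_isSubLmodule of image_mod by <:].

End ImageModule.

Section Projective.
Variable A : comNzRingType.

(** [is_projective] lifts along surjections, so both maps are corestricted to the image of [g]. *)
Lemma projective_lift (P M N : lmodType A) (f : {linear P -> N}) (g : {linear M -> N}) :
  is_projective P -> (forall x, exists y, g y = f x) ->
  exists h : {linear P -> M}, forall x, g (h x) = f x.
Proof.
move=> projP fg.
have in_im x : f x \in image_pred g by apply/image_predP/fg.
have in_im' x : g x \in image_pred g by apply/image_predP; exists x.
pose f' x : image_mod g := Sub (f x) (in_im x).
pose g' x : image_mod g := Sub (g x) (in_im' x).
have lf' : linear f' by move=> a x y; apply: val_inj; rewrite /= linearP.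
have lg' : linear g' by move=> a x y; apply: val_inj; rewrite /= linearP.
pose F : {linear P -> image_mod g} :=
  HB.pack f' (GRing.isLinear.Build _ _ _ _ f' lf').
pose G : {linear M -> image_mod g} :=
  HB.pack g' (GRing.isLinear.Build _ _ _ _ g' lg').
have [|h hE] := projP _ _ G F; last by exists h => x; move/(congr1 val): (hE x).
by case=> y yI; have /image_predP[x xE] := yI; exists x; apply: val_inj.
Qed.

Definition row_comb n (M : lmodType A) (x : 'I_n -> M) (v : 'rV[A]_n) : M :=
  \sum_i v 0 i *: x i.

Lemma row_comb_linear n (M : lmodType A) (x : 'I_n -> M) : linear (row_comb x).
Proof.
move=> a u v; rewrite /row_comb scaler_sumr -big_split /=.
by apply: eq_bigr => i _; rewrite !mxE scalerDl scalerA.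
Qed.

HB.instance Definition _ n (M : lmodType A) (x : 'I_n -> M) :=
  GRing.isLinear.Build A 'rV[A]_n M _ (@row_comb n M x) (row_comb_linear x).

Lemma rV_projective n : is_projective 'rV[A]_n.
Proof.
move=> M N g f gsurj.
have [x xE] : exists x : 'I_n -> M, forall i, g (x i) = f (delta_mx 0 i).
  exact: (@fin_all_exists _ _ (fun i y => g y = f (delta_mx 0 i))).
exists (row_comb x) => v; rewrite [v in RHS]row_sum_delta !linear_sum.
by apply: eq_bigr => i _; rewrite !linearZ /= xE.
Qed.

End Projective.

Section Comparison.
Variables (A : comNzRingType) (M : lmodType A).

Definition resolution (P : nat -> lmodType A) (d : forall i, {linear P i.+1 -> P i})
    (e : {linear P 0%N -> M}) : Prop :=
  [/\ forall y, exists x, e x = y,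
      forall x, e x = 0 <-> exists y, d 0%N y = x
    & forall i x, d i x = 0 <-> exists y, d i.+1 y = x].

(** The augmentation serves as the differential leaving degree 0, so that one induction covers all
    degrees. *)
Definition cycle (P : nat -> lmodType A) (d : forall i, {linear P i.+1 -> P i})
    (e : {linear P 0%N -> M}) n : P n -> Prop :=
  match n return P n -> Prop with
  | 0 => fun x => e x = 0
  | m.+1 => fun x => d m x = 0
  end.

Lemma cycleP (P : nat -> lmodType A) (d : forall i, {linear P i.+1 -> P i})
    (e : {linear P 0%N -> M}) n (x : P n) : resolution d e ->
  cycle d e x <-> exists y, d n y = x.
Proof. by case=> _ H0 HS; case: n x => [|n] x /=; [apply: H0|apply: HS]. Qed.

(* If [P] is minimal, i.e. [d] takes values in [J P], then a homotopy from the
   identity of [P] to [beta alpha] is zero modulo [J]. *)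
Lemma comparison (J : A -> Prop) (r : nat -> nat)
    (d : forall i, {linear 'rV[A]_(r i.+1) -> 'rV[A]_(r i)})
    (e : {linear 'rV[A]_(r 0%N) -> M})
    (Q : nat -> lmodType A) (d' : forall i, {linear Q i.+1 -> Q i})
    (e' : {linear Q 0%N -> M}) n :
  is_ideal J -> (forall i x b, J (d i x 0 b)) ->
  (forall i, is_projective (Q i)) ->
  resolution (P := fun i => 'rV[A]_(r i)) d e -> resolution d' e' ->
  exists (al : {linear 'rV[A]_(r n) -> Q n}) (be : {linear Q n -> 'rV[A]_(r n)}),
    forall x b, J ((x - be (al x)) 0 b).
Proof.
move=> idJ Jd projQ resd resd'.
have Jlin m m' (s : {linear 'rV[A]_m -> 'rV[A]_m'}) (x : 'rV_m) :
    (forall b, J (x 0 b)) -> forall b, J (s x 0 b).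
  move=> Jx b; rewrite [x]row_sum_delta linear_sum /= summxE.
  by apply: is_ideal_sum => // i _; rewrite linearZ mxE; apply: is_idealMr.
pose zP := cycle (P := fun i => 'rV[A]_(r i)) d e.
have zPP m x : @zP m x <-> exists y, d m y = x by exact: (@cycleP (fun i => 'rV[A]_(r i)) d e m x resd).
(* The induction remembers chain maps only through their action on cycles. The homotopy equation is
   also kept on cycles, where the term [s (d x)] of the lower homotopy vanishes. *)
suff [al [be [s [_ _ _ H]]]] : exists (al : {linear 'rV[A]_(r n) -> Q n})
    (be : {linear Q n -> 'rV[A]_(r n)})
    (s : {linear 'rV[A]_(r n) -> 'rV[A]_(r n.+1)}),
  [/\ forall x, @zP n x -> cycle d' e' (al x),
      forall x, cycle d' e' x -> @zP n (be x),
      forall x, @zP n x -> x - be (al x) = d n (s x)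
    & forall x b, J ((x - be (al x)) 0 b)].
  by exists al, be.
have projV := @rV_projective A.
elim: n => [|n [al [be [s [zal zbe sE _]]]]].
  have [esurj _ _] := resd; have [esurj' _ _] := resd'.
  have [al alE] := projective_lift (f := e) (projV _) (fun x => esurj' (e x)).
  have [be beE] := projective_lift (f := e') (projQ _) (fun x => esurj (e' x)).
  pose f : {linear 'rV[A]_(r 0%N) -> 'rV[A]_(r 0%N)} := idfun \- (be \o al).
  have [x|s sE] := projective_lift (f := f) (g := d 0%N) (projV _).
    by apply/zPP; rewrite /= linearB /= beE alE subrr.
  exists al, be, s; split=> [x|x|x _|x b] /=; rewrite ?alE ?beE ?sE //.
  by have := sE x => /= <-.
have [x|al' alE] := projective_lift (f := al \o d n) (g := d' n) (projV _).
  by apply/(cycleP _ resd')/zal/zPP; exists x.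
have [x|be' beE] := projective_lift (f := be \o d' n) (g := d n) (projQ _).
  by apply/zPP/zbe/(cycleP _ resd'); exists x.
pose f : {linear 'rV[A]_(r n.+1) -> 'rV[A]_(r n.+1)} :=
  idfun \- (be' \o al') \- (s \o d n).
have [x|s' sE'] := projective_lift (f := f) (g := d n.+1) (projV _).
  apply/zPP; rewrite /= !linearB /= beE /= alE /= -sE ?subrr //.
  by apply/zPP; exists x.
exists al', be', s'; split=> /=.
- by move=> x dx; rewrite alE /= dx linear0.
- by move=> x dx; rewrite beE /= dx linear0.
- by move=> x dx; rewrite sE' /= dx linear0 subr0.
move=> x b; have -> : x - be' (al' x) = d n.+1 (s' x) + s (d n x).
  by rewrite sE' /= subrK.
by rewrite mxE; apply: is_idealD => //; apply: Jlin.
Qed.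

End Comparison.

(** * Ranks of minimal free resolutions and projective dimension *)

Section FreeComplex.
Variables (k : fieldType) (n : nat).
Local Notation S := {mpoly k[n]}.
Local Notation irr := (@irrelevant_ideal k n).

Lemma is_ideal_gen (A : comNzRingType) (G : A -> Prop) : is_ideal (ideal_gen G).
Proof.
split=> [|f g [m [a [x [Gx ->]]]] [m' [a' [x' [Gx' ->]]]]|f g [m [a [x [Gx ->]]]]].
- by exists 0%N, (fun=> 0), (fun=> 0); split; [case|rewrite big_ord0].
- exists (m + m')%N, (fun i => match split i with inl j => a j | inr j => a' j end),
    (fun i => match split i with inl j => x j | inr j => x' j end); split.
    by move=> i; case: split => j; [apply: Gx|apply: Gx'].
  rewrite big_split_ord /=; congr (_ + _); apply: eq_bigr => i _.
    by rewrite (unsplitK (inl i)).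
  by rewrite (unsplitK (inr i)).
- exists m, (fun i => f * a i), x; split=> //.
  by rewrite mulr_sumr; apply: eq_bigr => i _; rewrite mulrA.
Qed.

Lemma ideal_gen_in (A : comNzRingType) (G : A -> Prop) g : G g -> ideal_gen G g.
Proof.
by move=> Gg; exists 1%N, (fun=> 1), (fun=> g); split=> //; rewrite big_ord1 mul1r.
Qed.

Lemma ideal_gen_min (A : comNzRingType) (G J : A -> Prop) f : is_ideal J ->
  (forall g, G g -> J g) -> ideal_gen G f -> J f.
Proof.
move=> idJ GJ [m [a [x [Gx ->]]]]; apply: is_ideal_sum => // i _.
by apply: is_idealMl => //; apply: GJ.
Qed.

Lemma is_ideal_irr : is_ideal irr. Proof. exact: is_ideal_gen. Qed.

Lemma irr_coef0 f : irr f -> f@_0%MM = 0.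
Proof.
apply: (@ideal_gen_min _ _ (fun g => g@_0%MM = 0)) => [|g [i ->]]; last by rewrite mcoeffX mnm1_eq0.
split=> [|g h g0 h0|g h h0]; first exact: mcoeff0.
  by rewrite mcoeffD g0 h0 addr0.
by rewrite rmorphM /= h0 mulr0.
Qed.

Lemma not_irr1 : ~ irr 1.
Proof. by move/irr_coef0/eqP; rewrite mcoeff1 eqxx oner_eq0. Qed.

Definition row_sum m (v : 'rV[S]_m) : S^o := \sum_b v 0 b.

Lemma row_sum_linear m : linear (@row_sum m).
Proof.
move=> a u v; rewrite /row_sum scaler_sumr -big_split /=.
by apply: eq_bigr => i _; rewrite !mxE.
Qed.

HB.instance Definition _ m :=
  GRing.isLinear.Build S 'rV[S]_m S^o _ (@row_sum m) (@row_sum_linear m).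

Lemma row_sum_ideal (I : S -> Prop) m (x : 'rV[S]_m) : m = 1%N ->
  I (row_sum x) <-> forall b, I (x 0 b).
Proof.
move=> m1; subst m; rewrite /row_sum big_ord1; split=> [Ix b|]; last exact.
by rewrite ord1.
Qed.

Variables (I : S -> Prop) (M : lmodType S) (pi : {linear S^o -> M}).
Hypothesis pi_quot : is_quotient_map I pi.
Implicit Types F G : free_complex k n.

Definition fmap F i : {linear 'rV[S]_(frank F i.+1) -> 'rV[S]_(frank F i)} :=
  mulmxr (fdiff F i).

Definition faug F : {linear 'rV[S]_(frank F 0) -> M} := pi \o @row_sum (frank F 0).

Lemma free_complex_resolution F : resolves_quotient I F ->
  resolution (P := fun i => 'rV[S]_(frank F i)) (fmap F) (faug F).
Proof.
case=> F0 _ exF0 exF; have [pisurj piI] := pi_quot; split=> [y|x|i x].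
- have [a <-] := pisurj y.
  have [x <-] : exists x : 'rV[S]_(frank F 0), row_sum x = a.
    by rewrite F0; exists a%:M; rewrite /row_sum big_ord1 mxE eqxx.
  by exists x.
- apply: (iff_trans _ (exF0 x)); apply: (iff_trans (piI _)).
  exact: row_sum_ideal.
- exact: exF.
Qed.

Lemma minimal_fmap F i x b : is_minimal F -> irr (fmap F i x 0 b).
Proof.
move=> minF; rewrite /fmap /= mxE; apply: is_ideal_sum => [|j _]; first exact: is_ideal_irr.
by apply: is_idealMl; [exact: is_ideal_irr|exact: minF].
Qed.

(** Taking constant terms in [comparison] factors an identity matrix over [k] through a space of
    dimension [frank G i]. *)
Lemma minimal_rank_le F G i : resolves_quotient I F -> resolves_quotient I G ->
  is_minimal F -> (frank F i <= frank G i)%N.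
Proof.
move=> resF resG minF.
have [al [be H]] := @comparison _ M _ _ _ _ _ _ _ i is_ideal_irr
  (fun i x b => minimal_fmap x b minF) (fun i => rV_projective (n := frank G i))
  (free_complex_resolution resF) (free_complex_resolution resG).
pose ev : {rmorphism S -> k} := mcoeff 0%MM.
pose a := map_mx ev (lin1_mx al); pose b := map_mx ev (lin1_mx be).
apply: (@mulmx1_min _ _ _ a b); rewrite -map_mxM -(map_mx1 ev).
apply/matrixP => x y; apply/eqP; rewrite -subr_eq0 -oppr_eq0 opprB !mxE -raddfB.
apply/eqP/irr_coef0.
have := H (delta_mx 0 x) y; rewrite -(mul_rV_lin1 al) -(mul_rV_lin1 be) -mulmxA -rowE.
by rewrite !mxE eqxx eq_sym.
Qed.

(** If [F_i = 0], every basis vector of [F_(i+1)] is a cycle, hence in the image of a differential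
    with entries in the irrelevant ideal, which would put 1 in that ideal. *)
Lemma minimal_rank0 F i : resolves_quotient I F -> is_minimal F ->
  frank F i = 0%N -> frank F i.+1 = 0%N.
Proof.
move=> [_ _ _ exF] minF Fi0; apply/eqP; rewrite -leqn0 leqNgt; apply/negP => Fi_gt0.
pose a := Ordinal Fi_gt0.
have [u uE] : exists u : 'rV_(frank F i.+2), u *m fdiff F i.+1 = delta_mx 0 a.
  by apply/exF; apply/rowP => j; have := ltn_ord j; rewrite {2}Fi0.
apply: not_irr1; have := minimal_fmap u a minF.
by rewrite /fmap /= uE mxE !eqxx.
Qed.

Lemma truncate_resolution F j : resolves_quotient I F -> is_minimal F ->
  frank F j.+1 = 0%N -> has_projective_resolution M j.
Proof.
move=> resF minF Fj; have [s0 s1 s2] := free_complex_resolution resF.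
exists (fun i => 'rV[S]_(frank F i)), (fmap F), (faug F); split=> // [i|i ji x].
  exact: rV_projective.
suff Fi : frank F i = 0%N by apply/rowP => b; have := ltn_ord b; rewrite {2}Fi.
rewrite -(subnK ji); elim: (_ - _)%N => // m IH.
by rewrite addSn; apply: minimal_rank0.
Qed.

(** The comparison factors through the zero module in degree [j.+1], so the identity of [F_(j+1)]
    vanishes modulo the irrelevant ideal. *)
Lemma projective_resolution_rank0 F j : resolves_quotient I F -> is_minimal F ->
  has_projective_resolution M j -> frank F j.+1 = 0%N.
Proof.
move=> resF minF [P [d [e [projP P0 s0 s1 s2]]]].
have resP : resolution d e by split.
have [al [be H]] := @comparison _ M _ _ _ _ _ _ _ j.+1 is_ideal_irr
  (fun i x b => minimal_fmap x b minF) projP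
  (free_complex_resolution resF) resP.
apply/eqP; rewrite -leqn0 leqNgt; apply/negP => F_gt0.
pose a := Ordinal F_gt0; apply: not_irr1.
have := H (delta_mx 0 a) a.
by rewrite (P0 _ (ltnSn j) (al _)) linear0 subr0 mxE !eqxx.
Qed.

End FreeComplex.

(** * Linear forms on the two factors *)

Section Substitution.
Variables (k : fieldType) (n : nat).
Local Notation S := {mpoly k[n]}.
Local Notation irr := (@irrelevant_ideal k n).

Definition subst (h : 'I_n -> S) : {rmorphism S -> S} :=
  comp_mpoly [tuple h i | i < n].

Lemma substX h i : subst h 'X_i = h i.
Proof. by rewrite /subst /= comp_mpolyXU -tnth_nth tnth_mktuple. Qed.

Lemma substZ h c f : subst h (c *: f) = c *: subst h f.
Proof. exact: comp_mpolyZ. Qed.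

Lemma subst_congr (J : S -> Prop) h f : is_ideal J ->
  (forall i, J (h i - 'X_i)) -> J (subst h f - f).
Proof.
move=> idJ Jh; elim/mpolyind: f => [|c m f _ _ IH].
  by rewrite rmorph0 subrr; apply: is_ideal0.
rewrite rmorphD opprD addrACA; apply: is_idealD => //.
rewrite substZ -scalerBr -mul_mpolyC; apply: is_idealMl => //.
rewrite mpolyXE_id rmorph_prod /=.
elim/big_ind2: _ => [||i _]; first by rewrite subrr; apply: is_ideal0.
  move=> x1 x2 y1 y2 J1 J2.
  have -> : x2 * y2 - x1 * y1 = (x2 - x1) * y2 + x1 * (y2 - y1) by ring.
  by apply: is_idealD => //; [apply: is_idealMr|apply: is_idealMl].
rewrite rmorphXn /= -/(subst h _) substX.
elim: (m i) => [|e IHe]; first by rewrite !expr0 subrr; apply: is_ideal0.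
have -> : h i ^+ e.+1 - 'X_i ^+ e.+1 =
    (h i - 'X_i) * h i ^+ e + 'X_i * (h i ^+ e - 'X_i ^+ e) by rewrite !exprS; ring.
by apply: is_idealD => //; [apply: is_idealMr|apply: is_idealMl].
Qed.

Lemma irrP f : irr f <-> f@_0%MM = 0.
Proof.
split=> [|f0]; first exact: irr_coef0.
have : irr (subst (fun=> 0) f - f).
  apply: subst_congr => [|i]; first exact: is_ideal_irr.
  by rewrite sub0r -mulN1r; apply: is_idealMl; [exact: is_ideal_irr|apply: ideal_gen_in; exists i].
suff -> : subst (fun=> 0) f = 0.
  by rewrite sub0r => /(is_idealN (@is_ideal_irr k n)); rewrite opprK.
rewrite [f]mpolyE rmorph_sum big_seq big1 // => m mf.
rewrite substZ mpolyXE_id rmorph_prod /=.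
have [i mi] : exists i, m i != 0%N.
  apply/existsP; apply: contraLR mf; rewrite negb_exists mcoeff_msupp => /forallP m0.
  suff -> : m = 0%MM by rewrite f0 eqxx.
  by apply/mnmP => i; rewrite mnm0E; apply/eqP; rewrite -[_ == _]negbK.
rewrite (bigD1 i) //= rmorphXn /= -/(subst _ _) substX expr0n (negPf mi).
by rewrite mul0r scaler0.
Qed.

End Substitution.

Section LinearForms.
Variable k : fieldType.
Local Notation S := {mpoly k[4]}.
Local Notation irr := (@irrelevant_ideal k 4).
Local Notation T := (option k).
Implicit Types (r q : T) (rs qs : seq T) (io : 'I_2 -> 'I_4).

(* [None] is the point [0 : 1] and [Some a] is the point [1 : a]; the form
   vanishing there is [coord r].1 z_0 - [coord r].2 z_1. *)
Definition coord r : k * k := if r is Some a then (a, 1) else (1, 0).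

Definition lform io r : S :=
  (coord r).1 *: 'X_(io 0) - (coord r).2 *: 'X_(io 1).

Local Notation xi := (@lshift 2 2).
Local Notation yi := (@rshift 2 2).
Definition lx := lform xi.
Definition ly := lform yi.
Definition px rs : S := \prod_(r <- rs) lx r.
Definition py qs : S := \prod_(q <- qs) ly q.

Lemma coord_det r r' : r != r' ->
  (coord r).1 * (coord r').2 - (coord r').1 * (coord r).2 != 0.
Proof.
case: r r' => [a|] [b|] //= rr'; rewrite ?mulr1 ?mulr0 ?mul1r ?subr0 ?sub0r ?oppr_eq0 ?oner_eq0 //.
by rewrite subr_eq0; apply: contra rr' => /eqP ->.
Qed.

(** Cramer's rule; the numerator of [c] is the determinant of [r] and [r1]. *)
Lemma lform_span io r r2 r1 : r != r2 -> exists a c : k,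
  (r1 != r -> c != 0) /\ lform io r1 = a *: lform io r + c *: lform io r2.
Proof.
move=> rr2; have D := coord_det rr2.
set d := _ - _ in D.
exists (((coord r1).1 * (coord r2).2 - (coord r2).1 * (coord r1).2) / d),
  (((coord r).1 * (coord r1).2 - (coord r1).1 * (coord r).2) / d); split.
  by rewrite eq_sym => /coord_det r1r; rewrite mulf_neq0 ?invr_eq0.
rewrite /lform !scalerBr !scalerA addrACA -opprD -!scalerDl.
by congr (_ *: _ - _ *: _); rewrite /d; field.
Qed.

Lemma var_span io r r2 i : r != r2 -> id2 (lform io r) (lform io r2) 'X_(io i).
Proof.
move=> rr2; have D := coord_det rr2; set d := _ - _ in D.
suff [a [b ->]] : exists a b : k, 'X_(io i) = a *: lform io r + b *: lform io r2.
  by exists a%:MP, b%:MP; rewrite !mul_mpolyC.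
have [->|->] : i = 0 \/ i = 1 by case: i => -[|[|//]] ?; [left|right]; apply: val_inj.
- exists ((coord r2).2 / d), (- (coord r).2 / d).
  rewrite /lform !scalerBr !scalerA addrACA -opprD -!scalerDl.
  rewrite [X in X *: _](_ : _ = 1) ?scale1r; last by rewrite /d; field.
  by rewrite [X in X *: _](_ : _ = 0) ?scale0r ?subr0 //; ring.
- exists ((coord r2).1 / d), (- (coord r).1 / d).
  rewrite /lform !scalerBr !scalerA addrACA -opprD -!scalerDl.
  rewrite [X in X *: _](_ : _ = 0) ?scale0r ?sub0r -?scaleNr; last by rewrite /d; field.
  by rewrite [X in X *: _](_ : _ = 1) ?scale1r // /d; field.
Qed.

Lemma lform_irr io r : irr (lform io r).
Proof.
have Xi i : irr ('X_i : S) by apply: ideal_gen_in; exists i.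
have idI := @is_ideal_irr k 4.
by rewrite /lform -!mul_mpolyC; apply: is_idealB => //; apply: is_idealMl.
Qed.

(** Modulo [lform io r], every factor is a nonzero multiple of [lform io r2]. *)
Lemma prod_lform io r r2 rs : r != r2 -> r \notin rs ->
  exists m (c : k), c != 0 /\
    \prod_(r' <- rs) lform io r' = m * lform io r + c *: lform io r2 ^+ size rs.
Proof.
move=> rr2; elim: rs => [|r1 rs IH].
  by exists 0, 1; rewrite oner_eq0 big_nil expr0 mul0r add0r scale1r.
rewrite in_cons negb_or => /andP[rr1 /IH[m [c [c0 E]]]].
have [a [d [/(_ _)d0 lE]]] := lform_span io r1 rr2.
have {}d0 : d != 0 by apply: d0; rewrite eq_sym.
exists (lform io r1 * m + a%:MP * (c *: lform io r2 ^+ size rs)), (d * c).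
rewrite mulf_neq0 // big_cons E; split=> //.
by rewrite mulrDr {2}lE -!mul_mpolyC mpolyCM exprS; ring.
Qed.

(* Substitution of the equation [lform io r = 0]. *)
Definition lsub io r : 'I_4 -> S := fun j =>
  if r is Some a then if j == io 1 then a *: 'X_(io 0) else 'X_j
  else if j == io 0 then 0 else 'X_j.

Section OneSide.
Variable io : 'I_2 -> 'I_4.
Hypothesis io_inj : injective io.

Let io01 : (io 0 == io 1) = false. Proof. by apply/negP => /eqP/io_inj. Qed.

Lemma subst_lform r : subst (lsub io r) (lform io r) = 0.
Proof.
rewrite /lform rmorphB !substZ !substX /lsub.
case: r => [a|] /=; rewrite ?eqxx ?io01 ?[io 1 == _]eq_sym ?io01.
  by rewrite scale1r subrr.
by rewrite scaler0 scale0r subrr.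
Qed.

Lemma lsub_congr r f : principal (lform io r) (subst (lsub io r) f - f).
Proof.
apply: subst_congr => [|j]; first exact: is_ideal_principal.
rewrite /lsub /lform; case: r => [a|] /=.
  case: eqP => [->|_]; last by rewrite subrr; exact: (is_ideal0 (is_ideal_principal _)).
  by apply/principalP; exists 1; rewrite mulr1 scale1r.
case: eqP => [->|_]; last by rewrite subrr; exact: (is_ideal0 (is_ideal_principal _)).
by apply/principalP; exists (- 1); rewrite scale1r scale0r subr0 mulrN1 sub0r.
Qed.

(** The substitution changes [f] by a multiple of the form and kills the form. Divisibility thus
    becomes vanishing in a domain, which is the source of all primality below. *)
Lemma principal_lform r f : principal (lform io r) f <-> subst (lsub io r) f = 0.
Proof.
split=> [/principalP[c ->]|E]; first by rewrite rmorphM subst_lform mul0r.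
rewrite -[f]opprK; apply: is_idealN; first exact: is_ideal_principal.
by have := lsub_congr r f; rewrite E sub0r.
Qed.

Lemma lform_neq0 r : lform io r != 0.
Proof.
apply/negP => /eqP/mpolyP E; case: r E => [a|] E.
  have := E U_(io 1%R)%MM; rewrite /lform /= mcoeffB !mcoeffZ !mcoeffXU io01 eqxx mcoeff0.
  by rewrite mulr0 sub0r mulr1 => /eqP; rewrite oppr_eq0 oner_eq0.
have := E U_(io 0%R)%MM; rewrite /lform /= mcoeffB !mcoeffZ !mcoeffXU eqxx mcoeff0.
by rewrite mul0r subr0 mulr1 => /eqP; rewrite oner_eq0.
Qed.

(** Otherwise the two forms would put both variables of this factor in the ideal, yet the
    substitution fixes one of them. *)
Lemma not_principal_lform r r' : r != r' -> ~ principal (lform io r) (lform io r').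
Proof.
move=> rr' H.
have P i : principal (lform io r) 'X_(io i).
  have [c [d ->]] := var_span io i rr'.
  have idP := is_ideal_principal (lform io r).
  apply: (is_idealD idP); last exact: (is_idealMl _ idP).
  by apply/principalP; exists c; rewrite mulrC.
have X0 (j : 'I_4) : ('X_j : S) != 0.
  by apply/negP => /eqP/mpolyP/(_ U_(j)%MM)/eqP; rewrite mcoeffXU eqxx mcoeff0 oner_eq0.
case: r {rr' H} P => [a|] P.
  have /principal_lform := P 0; rewrite substX /= io01 => /eqP.
  by rewrite (negPf (X0 _)).
have /principal_lform := P 1; rewrite substX /= eq_sym io01 => /eqP.
by rewrite (negPf (X0 _)).
Qed.

Lemma nzd_lform r f : ~ principal (lform io r) f -> nzd (principal (lform io r)) f.
Proof.
move=> /principal_lform /eqP f0 g /principal_lform; rewrite rmorphM => /eqP.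
by rewrite mulf_eq0 (negPf f0) => /eqP/principal_lform.
Qed.

Lemma nzd_lform2 r r' : r != r' -> nzd (principal (lform io r)) (lform io r').
Proof. by move=> rr'; apply/nzd_lform/not_principal_lform. Qed.

End OneSide.

Lemma subst_lx_ly r q : subst (lsub xi r) (ly q) = ly q.
Proof.
rewrite /ly /lform rmorphB !substZ !substX /lsub /=.
by case: r.
Qed.

Lemma subst_ly_lx r q : subst (lsub yi q) (lx r) = lx r.
Proof.
rewrite /lx /lform rmorphB !substZ !substX /lsub /=.
by case: q.
Qed.

Lemma lx_neq0 r : lx r != 0. Proof. exact: (lform_neq0 (@lshift_inj 2 2)). Qed.
Lemma ly_neq0 q : ly q != 0. Proof. exact: (lform_neq0 (@rshift_inj 2 2)). Qed.

Lemma nzd_lx_ly r q : nzd (principal (lx r)) (ly q).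
Proof.
have linj := @lshift_inj 2 2; apply: (nzd_lform linj) => /(principal_lform linj)/eqP.
by rewrite subst_lx_ly (negPf (ly_neq0 q)).
Qed.

Lemma nzd_ly_lx r q : nzd (principal (ly q)) (lx r).
Proof.
have rinj := @rshift_inj 2 2; apply: (nzd_lform rinj) => /(principal_lform rinj)/eqP.
by rewrite subst_ly_lx (negPf (lx_neq0 r)).
Qed.

Lemma nzd_lx r r' : r != r' -> nzd (principal (lx r)) (lx r').
Proof. exact: (nzd_lform2 (@lshift_inj 2 2)). Qed.

Lemma nzd_ly q q' : q != q' -> nzd (principal (ly q)) (ly q').
Proof. exact: (nzd_lform2 (@rshift_inj 2 2)). Qed.

Definition pt_subst (P : T * T) : {rmorphism S -> S} :=
  subst (lsub yi P.2) \o subst (lsub xi P.1).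

(** Each substitution fixes the forms of the other factor, so the composite kills both generators;
    conversely the two successive corrections are multiples of them. *)
Lemma pt_idealP P f : id2 (lx P.1) (ly P.2) f <-> pt_subst P f = 0.
Proof.
have linj := @lshift_inj 2 2; have rinj := @rshift_inj 2 2.
split=> [[c [d ->]]|/(principal_lform rinj)/principalP[d dE]].
  change (subst (lsub yi P.2) (subst (lsub xi P.1) (c * lx P.1 + d * ly P.2)) = 0).
  move: (subst_lx_ly P.1 P.2) (subst_lform linj P.1) (subst_lform rinj P.2).
  rewrite -/(lx P.1) -/(ly P.2).
  move: (subst _) (subst _) (lx P.1) (ly P.2) => sx sy l m Em El Em'.
  by rewrite rmorphD !rmorphM El Em mulr0 add0r rmorphM Em' mulr0.
have /principalP[c cE] := lsub_congr xi P.1 f.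
exists (- c), d; rewrite mulNr [c * _]mulrC [d * _]mulrC -cE -dE; ring.
Qed.

Lemma pt_ideal_prime P : is_prime_ideal (id2 (lx P.1) (ly P.2)).
Proof.
split=> [||a b]; first exact: is_ideal_id2.
  by move/pt_idealP/eqP; rewrite rmorph1 oner_eq0.
move=> /pt_idealP; rewrite rmorphM => /eqP; rewrite mulf_eq0.
by case/orP=> /eqP/pt_idealP; [left|right].
Qed.

Lemma nzd_pt P f : ~ id2 (lx P.1) (ly P.2) f -> nzd (id2 (lx P.1) (ly P.2)) f.
Proof. by case: (pt_ideal_prime P) => _ _ prP nf g /prP[]. Qed.

Lemma nzd_pt_lx P r : P.1 != r -> nzd (id2 (lx P.1) (ly P.2)) (lx r).
Proof.
have linj := @lshift_inj 2 2; have rinj := @rshift_inj 2 2.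
move=> Pr; apply: nzd_pt => -[a [b E]]; apply: (not_principal_lform linj Pr).
apply/principalP; exists (subst (lsub yi P.2) a).
rewrite -[LHS](subst_ly_lx r P.2) E.
move: (subst_ly_lx P.1 P.2) (subst_lform rinj P.2); rewrite -/(lx P.1) -/(ly P.2).
move: (subst _) (lx P.1) (ly P.2) => sy l m El Em.
by rewrite rmorphD !rmorphM El Em mulr0 addr0 mulrC.
Qed.

Lemma nzd_pt_ly P q : P.2 != q -> nzd (id2 (lx P.1) (ly P.2)) (ly q).
Proof.
have linj := @lshift_inj 2 2; have rinj := @rshift_inj 2 2.
move=> Pq; apply: nzd_pt => -[a [b E]]; apply: (not_principal_lform rinj Pq).
apply/principalP; exists (subst (lsub xi P.1) b).
rewrite -[LHS](subst_lx_ly P.1 q) E.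
move: (subst_lx_ly P.1 P.2) (subst_lform linj P.1); rewrite -/(lx P.1) -/(ly P.2).
move: (subst _) (lx P.1) (ly P.2) => sx l m Em El.
by rewrite rmorphD !rmorphM El Em mulr0 add0r mulrC.
Qed.

Lemma nzd_px_ly rs q : nzd (principal (px rs)) (ly q).
Proof.
apply: nzd_adj_prod => [|r _|r _]; first exact: is_ideal_zero.
  exact/nzd_field/lx_neq0.
exact: nzd_lx_ly.
Qed.

Lemma nzd_px_py rs qs : nzd (principal (px rs)) (py qs).
Proof. by apply: nzd_prod => q _; apply: nzd_px_ly. Qed.

Lemma nzd_py_lx qs r : nzd (principal (py qs)) (lx r).
Proof.
apply: nzd_adj_prod => [|q _|q _]; first exact: is_ideal_zero.
  exact/nzd_field/ly_neq0.
exact: nzd_ly_lx.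
Qed.

Lemma nzd_px_px rs rs' : {in rs & rs', forall r r', r != r'} ->
  nzd (principal (px rs)) (px rs').
Proof.
move=> rr'; apply: nzd_prod => r' r'r; apply: nzd_adj_prod => [|r rrs|r rrs].
- exact: is_ideal_zero.
- exact/nzd_field/lx_neq0.
- by apply: nzd_lx; apply: rr'.
Qed.

Lemma nzd_lx_lx_ly r r' q : r != r' ->
  nzd (adj (principal (lx r)) (lx r')) (ly q).
Proof.
move=> rr'; apply: nzd_swap; first exact: is_ideal_principal.
  exact: nzd_lx_ly.
by move=> f /id2E/(@nzd_pt_lx (r, q) _ rr')/id2E.
Qed.

Lemma nzd_px_px_py rs rs' qs : {in rs & rs', forall r r', r != r'} ->
  nzd (id2 (px rs) (px rs')) (py qs).
Proof.
move=> rr'; apply: nzd_prod => q _ f /id2E fI; apply/id2E.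
have id0 := @is_ideal_zero S; move: f fI.
apply: nzd_adj_prod => [|r' r'r|r' r'r]; first exact: is_ideal_principal.
  apply: nzd_adj_prod => // [r rrs|r rrs]; first exact/nzd_field/lx_neq0.
  by apply: nzd_lx; apply: rr'.
move=> f /adjC fI; apply: adjC; move: f fI.
have r'P r : r \in rs -> r' != r by rewrite eq_sym => /rr' -> //.
apply: nzd_adj_prod => [|r rrs|r rrs]; first exact: is_ideal_principal.
  by apply: nzd_lx; apply: r'P.
by apply: nzd_lx_lx_ly; apply: r'P.
Qed.

Lemma nzd_lx_py_lx r qs r' : r != r' -> nzd (id2 (py qs) (lx r)) (lx r').
Proof.
move=> rr' f /id2C/id2E fI; apply/id2C/id2E; move: f fI.
apply: nzd_adj_prod => [|q _|q _]; first exact: is_ideal_principal.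
  exact: nzd_lx_ly.
by move=> f /id2E/(@nzd_pt_lx (r, q) _ rr')/id2E.
Qed.

(** A grid is a complete intersection: for each row the columns are merged by [id2_inter], and then
    the rows are merged in the same way. *)
Lemma px_rect rs qs f : uniq rs -> uniq qs ->
  {in rs & qs, forall r q, id2 (lx r) (ly q) f} -> id2 (px rs) (py qs) f.
Proof.
move=> + uq fP; have {fP} : {in rs, forall r, id2 (py qs) (lx r) f}.
  move=> r rrs; apply/id2C; move: (fun q => fP r q rrs) uq => {}fP.
  elim: qs fP => [|q qs IH] fP; first by exists 0, f; rewrite /py big_nil; ring.
  move=> /andP[qqs uqs]; rewrite /py big_cons mulrC; apply: id2_inter.
  - apply: nzd_prod => q' q'qs; apply: (@nzd_pt_ly (r, q)).
    by apply: contraNneq qqs => /= ->.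
  - by apply: IH => // q' q'qs; apply: fP => //; rewrite in_cons q'qs orbT.
  - by apply: fP => //; rewrite mem_head.
move=> fP urs; apply/id2C; elim: rs urs fP => [|r rs IH] /=.
  by exists 0, f; rewrite /px big_nil; ring.
move=> /andP[rrs urs] fP; rewrite /px big_cons mulrC; apply: id2_inter.
- apply: nzd_prod => r' r'rs; apply: nzd_lx_py_lx.
  by apply: contraNneq rrs => ->.
- by apply: IH => // r' r'rs; apply: fP => //; rewrite in_cons r'rs orbT.
- by apply: fP => //; rewrite mem_head.
Qed.

Lemma px_rect2 rs qs f : uniq rs -> uniq qs ->
  {in rs & qs, forall r q, sq2 (lx r) (ly q) f} -> sq2 (px rs) (py qs) f.
Proof.
move=> + uq fP; have {fP} : {in rs, forall r, sq2 (py qs) (lx r) f}.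
  move=> r rrs; apply/sq2C; move: (fun q => fP r q rrs) uq => {}fP.
  elim: qs fP => [|q qs IH] fP; first by exists 0, 0, f; rewrite /py big_nil; ring.
  move=> /andP[qqs uqs]; rewrite /py big_cons mulrC; apply: sq2_inter.
  - exact/nzd_field/lx_neq0.
  - exact: nzd_lx_ly.
  - apply: nzd_prod => q' q'qs; apply: (@nzd_pt_ly (r, q)).
    by apply: contraNneq qqs => /= ->.
  - by apply: IH => // q' q'qs; apply: fP => //; rewrite in_cons q'qs orbT.
  - by apply: fP => //; rewrite mem_head.
move=> fP urs; apply/sq2C; elim: rs urs fP => [|r rs IH] /=.
  by exists 0, 0, f; rewrite /px big_nil; ring.
move=> /andP[rrs urs] fP; rewrite /px big_cons mulrC; apply: sq2_inter.
- by apply: nzd_prod => q _; apply/nzd_field/ly_neq0.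
- exact: nzd_py_lx.
- apply: nzd_prod => r' r'rs; apply: nzd_lx_py_lx.
  by apply: contraNneq rrs => ->.
- by apply: IH => // r' r'rs; apply: fP => //; rewrite in_cons r'rs orbT.
- by apply: fP => //; rewrite mem_head.
Qed.

End LinearForms.

(** * Sets of points of depth at least two *)

Section PointSets.
Variable k : fieldType.
Local Notation S := {mpoly k[4]}.
Local Notation irr := (@irrelevant_ideal k 4).
Local Notation T := (option k).
Local Notation xi := (@lshift 2 2).
Local Notation yi := (@rshift 2 2).
Implicit Types (Y : seq (T * T)) (r q : T) (rs qs : seq T) (f g : S).

Definition IX Y f : Prop := forall P, P \in Y -> id2 (lx P.1) (ly P.2) f.
Definition IZ Y f : Prop := forall P, P \in Y -> sq2 (lx P.1) (ly P.2) f.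

Lemma is_ideal_IX Y : is_ideal (IX Y).
Proof.
split=> [P _|f g If Ig P PY|f g Ig P PY].
- exact: is_ideal0 (is_ideal_id2 _ _).
- exact: is_idealD (is_ideal_id2 _ _) (If P PY) (Ig P PY).
- exact: is_idealMl (is_ideal_id2 _ _) (Ig P PY).
Qed.

Lemma nzd_IX_lx Y r : r \notin unzip1 Y -> nzd (IX Y) (lx r).
Proof.
move=> rY f If P PY; apply: (nzd_pt_lx (P := P)) (If P PY).
by apply: contraNneq rY => <-; apply: map_f.
Qed.

Lemma nzd_IX_ly Y q : q \notin unzip2 Y -> nzd (IX Y) (ly q).
Proof.
move=> qY f If P PY; apply: (nzd_pt_ly (P := P)) (If P PY).
by apply: contraNneq qY => <-; apply: map_f.
Qed.

Lemma nzd_IZ_lx Y r : r \notin unzip1 Y -> nzd (IZ Y) (lx r).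
Proof.
move=> rY f If P PY; apply: nzd_sq2 (If P PY).
- exact: nzd_lx_ly.
- exact: nzd_ly_lx.
- exact/nzd_field/lx_neq0.
- exact/nzd_field/ly_neq0.
- by apply: nzd_pt_lx; apply: contraNneq rY => <-; apply: map_f.
Qed.

Lemma px_split rs r : r \in rs -> exists c, px rs = c * lx r.
Proof. by move=> rrs; rewrite /px (big_rem r) //= mulrC; eexists. Qed.

Lemma py_split qs q : q \in qs -> exists c, py qs = c * ly q.
Proof. by move=> qqs; rewrite /py (big_rem q) //= mulrC; eexists. Qed.

Lemma px_pt rs P : P.1 \in rs -> id2 (lx P.1) (ly P.2) (px rs).
Proof. by case/px_split => c ->; exists c, 0; ring. Qed.

Lemma py_pt qs P : P.2 \in qs -> id2 (lx P.1) (ly P.2) (py qs).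
Proof. by case/py_split => c ->; exists 0, c; ring. Qed.

(* Cohen-Macaulayness of [S/I_X], tested on linear forms that vanish at no
   point of [X]. *)
Definition cm Y : Prop := forall r q, r \notin unzip1 Y -> q \notin unzip2 Y ->
  nzd (adj (IX Y) (lx r)) (ly q).

Definition depth_ge2 Y : Prop := exists f1 f2,
  [/\ irr f1, irr f2, nzd (IX Y) f1 & nzd (adj (IX Y) f1) f2].

Lemma irr_step (K : S -> Prop) f g : is_ideal K ->
  (forall i : 'I_4, K ('X_i * g)) -> irr f -> K (f * g).
Proof.
move=> idK Kg; apply: (@ideal_gen_min _ _ (fun f => K (f * g))) => [|h [i ->]//].
split=> [|a b Ka Kb|a b Kb]; first by rewrite mul0r; apply: is_ideal0.
  by rewrite mulrDl; apply: is_idealD.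
by rewrite -mulrA; apply: is_idealMl.
Qed.

(** Here [(l, s)] and [(h, s')] contain the variables of the two factors, so a power of the
    irrelevant ideal multiplies [g] into [K]. By induction on [n + n'], [s * g] and [s' * g] are
    already in [K]; hence so are all ['X_i * g]. *)
Lemma irrelevant_colon (K : S -> Prop) (l s h s' : S) n n' g : is_ideal K ->
    (forall g, (forall i : 'I_4, K ('X_i * g)) -> K g) ->
    (forall i, id2 l s 'X_(xi i)) -> (forall i, id2 h s' 'X_(yi i)) ->
  K (l * g) -> K (h * g) -> K (s ^+ n * g) -> K (s' ^+ n' * g) -> K g.
Proof.
move=> idK Kcol xP yP; have [N] := ubnP (n + n')%N.
elim: N => // N IH in n n' g *; rewrite ltnS => nN Kl Kh.
case: n nN => [|n] nN; first by rewrite expr0 mul1r.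
case: n' nN => [|n'] nN; first by rewrite expr0 mul1r.
rewrite !exprSr -!mulrA => Ks Ks'.
have K1 : K (s * g).
  apply: (IH n n'.+1) => //.
  - by rewrite mulrCA; apply: is_idealMl.
  - by rewrite mulrCA; apply: is_idealMl.
  have -> : s' ^+ n'.+1 * (s * g) = s * (s' ^+ n' * (s' * g)) by rewrite exprSr; ring.
  exact: is_idealMl.
have K2 : K (s' * g).
  apply: (IH n.+1 n') => //; first by rewrite addSnnS.
  - by rewrite mulrCA; apply: is_idealMl.
  - by rewrite mulrCA; apply: is_idealMl.
  have -> : s ^+ n.+1 * (s' * g) = s' * (s ^+ n * (s * g)) by rewrite exprSr; ring.
  exact: is_idealMl.
have Kspan a b c d : K (a * g) -> K (b * g) -> K ((c * a + d * b) * g).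
  by move=> Ka Kb; rewrite mulrDl -!mulrA; apply: is_idealD => //; apply: is_idealMl.
apply: Kcol => i; rewrite -(splitK (i : 'I_(2 + 2))); case: (split _) => j /=.
  by have [c [d ->]] := xP j; apply: Kspan.
by have [c [d ->]] := yP j; apply: Kspan.
Qed.

Lemma other_point r : exists r', r != r'.
Proof. by case: r => [a|]; [exists None|exists (Some 0)]. Qed.

(** With [K = I_X + (lx r)], [regular_exchange] shows that [K] equals its colon by the irrelevant
    ideal. The product of all row forms lies in [I_X] and is, modulo [lx r], a nonzero multiple of a
    power of [lx r']; the columns behave alike modulo [ly q], so [irrelevant_colon] applies. *)
Lemma depth_ge2_cm Y : depth_ge2 Y -> cm Y.
Proof.
move=> [f1 [f2 [m1 m2 n1 n2]]] r q rY qY g Kg.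
have idI := is_ideal_IX Y; have idK := is_ideal_adj (lx r) idI.
have [r' rr'] := other_point r; have [q' qq'] := other_point q.
have unitZ (c : k) (a b : S) : c != 0 -> adj (IX Y) (lx r) (c *: a * b) -> adj (IX Y) (lx r) (a * b).
  move=> c0 Kab; rewrite -[a * b]scale1r -(mulVf c0) -scalerA scalerAl -mul_mpolyC.
  exact: is_idealMl.
apply: (irrelevant_colon (n := size (unzip1 Y)) (n' := size (unzip2 Y)) idK _
  (fun i => var_span xi i rr') (fun i => var_span yi i qq')) => //.
- move=> h Kh; apply: regular_exchange n1 n2 (nzd_IX_lx rY) _ _ => //.
    exact: irr_step.
  exact: irr_step.
- by rewrite mulrC; apply: adj_gen.
- have [m [c [c0 E]]] := prod_lform xi rr' rY.
  apply: (unitZ c) => //; rewrite -[c *: _](addKr (m * lform xi r)) -E.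
  rewrite mulrDl; apply: is_idealD => //.
    by rewrite mulNr -mulrN mulrAC; apply: adj_gen.
  apply: sub_adj; apply: (is_idealMr _ idI) => P PY.
  by apply: (px_pt (rs := unzip1 Y)); apply: map_f.
- have [m [c [c0 E]]] := prod_lform yi qq' qY.
  apply: (unitZ c) => //; rewrite -[c *: _](addKr (m * lform yi q)) -E.
  rewrite mulrDl; apply: is_idealD => //.
    by rewrite mulNr -mulrA; apply: is_idealN => //; apply: is_idealMl.
  apply: sub_adj; apply: (is_idealMr _ idI) => P PY.
  by apply: (py_pt (qs := unzip2 Y)); apply: map_f.
Qed.

Definition xzero (j : 'I_4) : S :=
  if split (j : 'I_(2 + 2)) is inr _ then 'X_j else 0.

Lemma xzero_lx r : subst xzero (lx r) = 0.
Proof.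
rewrite /lx /lform rmorphB !substZ !substX /xzero.
by rewrite !(unsplitK (inl _ : 'I_2 + 'I_2)) !scaler0 subrr.
Qed.

Lemma xzero_ly q : subst xzero (ly q) = ly q.
Proof.
rewrite /ly /lform rmorphB !substZ !substX /xzero.
by rewrite !(unsplitK (inr _ : 'I_2 + 'I_2)).
Qed.

Hypothesis k_infinite : forall rs : seq T, exists r, r \notin rs.

Definition row_complete Y r := all (fun q => (r, q) \in Y) (unzip2 Y).

(** It suffices to treat one pair of forms, chosen off all of [Y], because [depth_ge2_cm] covers the
    others. The product [px rs] of the complete rows carries [I_Y'] into [I_Y], so
    [px rs * g = j + w * lx r] with [j] in [I_Y]. Then [w] vanishes on the grid of complete rows,
    and its part along [px rs] corrects [g]. *)
Lemma cm_remove_rows Y : cm Y -> cm [seq P <- Y | ~~ row_complete Y P.1].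
Proof.
move=> cmY; set Y' := filter _ _; apply: depth_ge2_cm.
have [r rY] := k_infinite (unzip1 Y); have [q qY] := k_infinite (unzip2 Y).
have idI := is_ideal_IX Y; have idI' := is_ideal_IX Y'.
have subY' : {subset Y' <= Y} by move=> P; rewrite mem_filter => /andP[].
exists (lx r), (ly q); split; rewrite ?lform_irr //.
- exact: lform_irr.
- exact: lform_irr.
- by apply: nzd_IX_lx; apply: contra rY => /mapP[P /subY' PY ->]; apply: map_f.
move=> g [i [c [Ii E]]].
pose rs := undup [seq r' <- unzip1 Y | row_complete Y r']; pose qs := undup (unzip2 Y).
have rsP P : P \in Y -> P.1 \notin rs -> P \in Y'.
  move=> PY; rewrite mem_undup mem_filter negb_and mem_filter => /orP[->//|].
  by rewrite map_f.
have [j [w [Ij gE]]] : adj (IX Y) (lx r) (px rs * g).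
  apply: (cmY r q) => //; exists (px rs * i), (px rs * c); split.
    move=> P PY; have [Prs|Prs] := boolP (P.1 \in rs).
      by apply: is_idealMr (px_pt _); first exact: is_ideal_id2.
    by apply: is_idealMl (Ii _ _); [exact: is_ideal_id2|exact: rsP].
  by rewrite mulrCA E; ring.
have [a [b wE]] : id2 (px rs) (py qs) w.
  apply: px_rect; rewrite ?undup_uniq // => r0 q0.
  rewrite !mem_undup mem_filter => /andP[fr0 r0Y] q0Y.
  have rqY : (r0, q0) \in Y by apply: (allP fr0).
  apply: (@nzd_pt_lx k (r0, q0) r) => /=; first by apply: contraNneq rY => <-.
  rewrite mulrC -[w * _](addKr j) -gE addrC.
  have idP := is_ideal_id2 (lx r0) (ly q0).
  apply: (is_idealB idP); last exact: (Ij (r0, q0)).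
  apply: (is_idealMr _ idP); apply: (@px_pt _ (r0, q0)).
  by rewrite mem_undup mem_filter fr0.
exists (g - a * lx r), a; split; last by ring.
have IY : IX Y (px rs * (g - a * lx r)).
  have -> : px rs * (g - a * lx r) = j + b * lx r * py qs by rewrite mulrBr gE wE; ring.
  apply: (is_idealD idI) => //; apply: (is_idealMl _ idI) => P PY.
  by apply: py_pt; rewrite mem_undup map_f.
move=> P PY'; have := IY P (subY' _ PY').
apply: nzd_prod => r0; rewrite mem_undup mem_filter => /andP[fr0 _].
apply: nzd_pt_lx; move: PY'; rewrite mem_filter => /andP[nf _].
by apply: contraNneq nf => ->.
Qed.

(** Binary forms of degree at least [n + size qs - 1] lie in the complete intersection of
    [ly q ^+ n] and [py qs]. Each factor [d] is split into a multiple of [ly q], lowering [n], and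
    one of [ly q0], shortening [qs]. *)
Lemma ly_span_power q qs (ds : seq T) n : q \notin qs -> (n + size qs <= (size ds).+1)%N ->
  id2 (ly q ^+ n) (py qs) (py ds).
Proof.
elim: ds n qs => [|d ds IH] n qs qqs; case: n => [|n].
- by exists (py [::]), 0; rewrite expr0; ring.
- rewrite addSn !ltnS leqn0 addn_eq0 => /andP[_ /nilP ->].
  by exists 0, 1; rewrite /py !big_nil; ring.
- by exists (py (d :: ds)), 0; rewrite expr0; ring.
case: qs qqs => [|q0 qs]; first by exists 0, (py (d :: ds)); rewrite /py big_nil; ring.
move=> /[dup] qqs; rewrite in_cons negb_or => /andP[qq0 qqs'] /= sz.
have [a [c [_ dE]]] := lform_span yi d qq0.
have /(IH n _ qqs)[m1 [m2 E1]] : (n + size (q0 :: qs) <= (size ds).+1)%N by rewrite /=; lia.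
have /(IH n.+1 _ qqs')[m3 [m4 E2]] : (n.+1 + size qs <= (size ds).+1)%N by lia.
exists (a%:MP * m1 + c%:MP * ly q0 * m3), (a%:MP * ly q * m2 + c%:MP * m4).
have -> : py (d :: ds) = a%:MP * ly q * py ds + c%:MP * ly q0 * py ds.
  by rewrite /py big_cons {1}/ly dE -!mul_mpolyC mulrDl.
rewrite {1}E1 E2 exprS /py big_cons; ring.
Qed.

(** Lagrange interpolation: the products omitting one form span the binary forms of degree
    [size rs - 1], among them a power of [lx r], which cancels modulo [K]. *)
Lemma lx_combine (K : S -> Prop) r rs f : is_ideal K -> nzd K (lx r) ->
    r \notin rs -> uniq rs -> rs != [::] ->
  (forall i, i \in rs -> K (px (rem i rs) * f)) -> K f.
Proof.
move=> idK nK; elim: rs f => // r0 rs IH f.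
rewrite in_cons negb_or => /andP[rr0 rrs] /= /andP[r0rs urs] _ Kf.
have := Kf r0 (mem_head _ _); rewrite /= eqxx => Kr0.
case: rs => [|r1 rs'] in IH rrs r0rs urs Kf Kr0 *.
  by move: Kr0; rewrite /px big_nil mul1r.
set rs := r1 :: rs' in IH rrs r0rs urs Kf Kr0 *.
have Kl : K (lx r0 * f).
  apply: IH => // i irs; have := Kf i; rewrite in_cons irs orbT => /(_ isT).
  have /negPf ir0 : r0 != i by apply: contraNneq r0rs => ->.
  by rewrite /= ir0 /px big_cons mulrA [lx r0 * _]mulrC.
have r0r : r0 != r by rewrite eq_sym.
have [m [c [c0 E]]] := prod_lform xi r0r r0rs.
apply: (nzdX (n := size rs) nK).
have -> : lx r ^+ size rs * f = (c^-1)%:MP * (px rs * f - m * (lx r0 * f)).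
  have -> : px rs * f - m * (lx r0 * f) = c%:MP * (lx r ^+ size rs * f).
    by rewrite /px E -mul_mpolyC /lx; ring.
  by rewrite !mulrA -mpolyCM mulVf // mpolyC1 mul1r.
by apply: is_idealMl => //; apply: is_idealB => //; apply: is_idealMl.
Qed.

Lemma principal_py qs f : uniq qs ->
  (forall q, q \in qs -> principal (ly q) f) -> principal (py qs) f.
Proof.
elim: qs => [|q qs IH] /=; first by move=> _ _; apply/principalP; exists f; rewrite /py big_nil mul1r.
move=> /andP[qqs uqs] Hf; rewrite /py big_cons mulrC; apply: principal_inter.
- apply: nzd_prod => q' q'qs; apply: nzd_ly.
  by apply: contraNneq qqs => ->.
- by apply: IH => // q' q'qs; apply: Hf; rewrite in_cons q'qs orbT.
- by apply: Hf; rewrite mem_head.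
Qed.

Lemma max_mem (I : eqType) (s : seq I) (F : I -> nat) : s != [::] ->
  exists2 x, x \in s & {in s, forall y, (F y <= F x)%N}.
Proof.
elim: s => // x [|y s] IH _.
  by exists x => [|z]; rewrite ?mem_head // inE => /eqP ->.
have [//|z zs zmax] := IH; have [Fzx|Fxz] := leqP (F z) (F x).
  exists x; rewrite ?mem_head // => t; rewrite in_cons => /orP[/eqP -> //|/zmax Ft].
  exact: leq_trans Ft Fzx.
exists z; rewrite ?(in_cons x) ?zs ?orbT // => t; rewrite in_cons => /orP[/eqP ->|/zmax //].
exact: ltnW.
Qed.

(* With [n1] the maximal number of points on a row, a row with [n1] points has
   points in every column: if it misses the column [q0], then the product [H] of
   the other columns lies in [I_X + (h^c)] with [c + n1] the number of columns
   (interpolation on each row), and setting [x = 0] shows that this is absurd. *)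
Lemma cm_full_row Y : cm Y -> Y != [::] ->
  exists2 r, r \in unzip1 Y & row_complete Y r.
Proof.
move=> cmY Y0; have idI := is_ideal_IX Y.
pose rows := undup (unzip1 Y); pose cols := undup (unzip2 Y).
pose N r := [seq q <- cols | (r, q) \in Y].
have rows0 : rows != [::].
  by case: Y Y0 @rows {cmY idI cols N} => // P Y _ rows; apply/eqP => E;
    have := mem_head P.1 (unzip1 Y); rewrite -mem_undup -/(unzip1 (P :: Y)) -/rows E.
have [r1 r1rows maxr1] := max_mem (fun r => size (N r)) rows0.
exists r1; first by rewrite -mem_undup.
apply/negPn/negP => /allPn[q0 q0Y r1q0].
have q0cols : q0 \in cols by rewrite mem_undup.
have szN : (size (N r1) < size cols)%N.
  rewrite size_filter -(count_predC (fun q => (r1, q) \in Y) cols) -ltn_psubLR ?subnn.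
    by rewrite -has_count; apply/hasP; exists q0.
  by rewrite -has_count; apply/hasP; exists q0.
have [r rY] := k_infinite (unzip1 Y); have [q qY] := k_infinite (unzip2 Y).
(* [H] has [size cols - 1] factors, and on every row [c + size (N r2)] is at most [size cols], which
   is exactly the bound of [ly_span_power]. *)
pose c := (size cols - size (N r1))%N; have c_gt0 : (0 < c)%N by rewrite subn_gt0.
pose J := adj (IX Y) (ly q ^+ c); have idJ : is_ideal J by apply: is_ideal_adj.
have nJ : nzd J (lx r).
  apply: nzd_adjX => //; first exact: nzd_IX_ly.
  by apply: nzd_swap => //; [exact: nzd_IX_lx|exact: cmY].
pose H := py (rem q0 cols).
have [i [w [Ii HE]]] : J H.
  apply: (lx_combine (r := r) (rs := rows)) => //; rewrite ?mem_undup ?undup_uniq //.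
  move=> r2 r2rows.
  have [||a [b HE]] := @ly_span_power q (N r2) (rem q0 cols) c.
  - by rewrite mem_filter mem_undup (negPf qY) andbF.
  - rewrite size_rem // prednK; last by rewrite (leq_ltn_trans _ szN).
    by rewrite /c -leq_subRL ?leq_subr // subKn ?maxr1 // ltnW.
  exists (b * (px (rem r2 rows) * py (N r2))), (px (rem r2 rows) * a); split; last first.
    by rewrite /H HE; ring.
  apply: (is_idealMl _ idI) => P PY; have idP := is_ideal_id2 (lx P.1) (ly P.2).
  have [Pr2|Pr2] := eqVneq P.1 r2.
    apply: (is_idealMl _ idP); apply: py_pt.
    by rewrite mem_filter mem_undup map_f // andbT -Pr2 -surjective_pairing.
  apply: (is_idealMr _ idP); apply: px_pt.
  by rewrite mem_rem_uniq ?undup_uniq // inE Pr2 mem_undup map_f.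
have h0py qs : subst xzero (py qs) = py qs.
  by rewrite /py rmorph_prod; apply: eq_bigr => q2 _; apply: xzero_ly.
(* Setting [x = 0] leaves, for each point, a multiple of the form of its column. *)
have /principalP[m mE] : principal (py cols) (subst xzero i).
  apply: principal_py => [|q2]; rewrite ?undup_uniq // mem_undup => /mapP[P PY ->].
  have [a [b ->]] := Ii P PY; apply/principalP; exists (subst xzero b).
  by rewrite rmorphD !rmorphM /= xzero_lx xzero_ly mulr0 add0r mulrC.
have : principal (ly q) (H * (1 - ly q0 * m)).
  apply/principalP; exists (subst xzero w * ly q ^+ c.-1).
  have -> : H * (1 - ly q0 * m) = H - py cols * m.
    by rewrite /H /py [X in _ = _ - X * _](big_rem q0) //=; ring.
  have HE' : H = subst xzero i + subst xzero w * ly q ^+ c.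
    by rewrite -[LHS](h0py (rem q0 cols)) -/H HE rmorphD rmorphM rmorphXn xzero_ly.
  rewrite -mE {1}HE'; by rewrite -{1}(prednK c_gt0) exprS; ring.
have qcols q2 : q2 \in rem q0 cols -> q != q2.
  by move=> /mem_rem; rewrite mem_undup; apply: contraTneq => <-.
have nH : nzd (principal (ly q)) H.
  by apply: nzd_prod => q2 /qcols; apply: nzd_ly.
move=> /nH/principalP[e eE].
(* Cancelling [H] modulo [ly q] has written 1 as a combination of [ly q] and [ly q0]. *)
apply: (@not_irr1 k 4).
have -> : 1 = ly q * e + ly q0 * m by rewrite -eE subrK.
have idirr := @is_ideal_irr k 4.
by apply: is_idealD => //; apply: is_idealMr => //; apply: lform_irr.
Qed.

End PointSets.

(** * Staircases of points *)

Section StaircaseOfPoints.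
Variable k : fieldType.
Local Notation S := {mpoly k[4]}.
Local Notation T := (option k).
Implicit Types (Y : seq (T * T)) (r q : T) (s : seq (seq T * seq T)) (f g : S).

Definition srows s := flatten (unzip1 s).
Definition scols s := flatten (unzip2 s).

(* Block [i] of rows meets the columns of the blocks [j >= i]. *)
Fixpoint spts s : seq (T * T) :=
  if s is x :: s' then [seq (r, q) | r <- x.1, q <- x.2 ++ scols s'] ++ spts s'
  else [::].

Definition sforms s : seq (S * S) := [seq (px x.1, py x.2) | x <- s].

(** [cm] is required of the tail of each block, where the colon computation uses it. *)
Fixpoint sgood s : Prop :=
  if s is x :: s' then
    [/\ uniq (x.1 ++ srows s'), uniq (x.2 ++ scols s'),
        x.1 != [::] /\ x.2 != [::], cm (spts s') & sgood s']
  else True.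

Lemma mem_spts s P : P \in spts s -> P.1 \in srows s /\ P.2 \in scols s.
Proof.
elim: s => //= x s IH; rewrite /srows /scols /= !mem_cat => /orP[|/IH[-> ->]].
  by case/allpairsP => -[r q] /= [rx qx ->] /=; rewrite rx; rewrite mem_cat in qx.
by rewrite !orbT.
Qed.

Lemma spts_row s r : r \notin srows s -> r \notin unzip1 (spts s).
Proof. by apply: contra => /mapP[P /mem_spts[+ _] ->]. Qed.

Lemma spts_col s q : q \notin scols s -> q \notin unzip2 (spts s).
Proof. by apply: contra => /mapP[P /mem_spts[_ +] ->]. Qed.

Lemma py_cat (qs qs' : seq T) : py (qs ++ qs') = py qs * py qs'.
Proof. exact: big_cat. Qed.

Lemma scol_sforms s : scol (sforms s) = py (scols s).
Proof.
elim: s => [|x s IH]; first by rewrite /py big_nil.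
by rewrite /= IH -py_cat.
Qed.

Lemma uniq_cat_notin (r : T) (rs rs' : seq T) : uniq (rs ++ rs') -> r \in rs -> r \notin rs'.
Proof. by rewrite cat_uniq => /and3P[_ /hasPn H _] rrs; apply/negP => /H /=; rewrite rrs. Qed.

(** The first rows form a grid, so [f = c * px rs + d * B] by [px_rect]. As [B] vanishes on the tail
    and [px rs] is a nonzerodivisor there, [c] belongs to the tail ideal. *)
Lemma IX_sI s f : sgood s -> IX (spts s) f <-> sI (sforms s) f.
Proof.
elim: s f => [|[rs qs] s IH] f /=; first by split.
move=> [urs uqs _ _ gs]; rewrite scol_sforms -py_cat.
have ur := uniq_cat_notin urs; split=> [If|[c [i [/(IH _ gs) Ii ->]]] P].
  have [c [d E]] : id2 (px rs) (py (qs ++ scols s)) f.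
    apply: px_rect => //; first by move: urs; rewrite cat_uniq => /andP[].
    by move=> r q rrs qqs; apply: (If (r, q)); rewrite mem_cat allpairs_f.
  exists d, c; split; last by rewrite E; ring.
  apply/(IH _ gs); have nu : nzd (IX (spts s)) (px rs).
    by apply: nzd_prod => r /ur/spts_row; apply: nzd_IX_lx.
  apply: nu; have -> : px rs * c = f - d * py (qs ++ scols s) by rewrite E; ring.
  apply: (is_idealB (is_ideal_IX _)) => P Ps.
    by apply: If; rewrite mem_cat Ps orbT.
  apply: (is_idealMl _ (is_ideal_id2 _ _)); apply: py_pt.
  by rewrite mem_cat (mem_spts Ps).2 orbT.
have idP := is_ideal_id2 (lx P.1) (ly P.2).
rewrite mem_cat => PY; apply: (is_idealD idP).
  apply: (is_idealMl _ idP); apply: py_pt; case/orP: PY => [|/mem_spts[_ Pc]].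
    by case/allpairsP => -[r q] /= [_ qx ->].
  by rewrite mem_cat Pc orbT.
case/orP: PY => [|/Ii]; last by apply: is_idealMl.
case/allpairsP => -[r q] [/= rrs _ PE]; apply: (is_idealMr _ idP); apply: px_pt.
by rewrite PE.
Qed.

(** The third condition of [colon_ok] is the property [cm] of the remaining points, extended from
    single linear forms to products. *)
Lemma IZ_sJ_aux s : sgood s -> cm (spts s) -> forall rs qs,
  (forall r, r \in rs -> r \notin srows s) -> (forall q, q \in qs -> q \notin scols s) ->
  colon_ok (sforms s) (px rs) (py qs).
Proof.
elim: s => [|[rs1 qs1] s IH] //= gs cms rs qs rsP qsP.
have [urs uqs _ cms' gs'] := gs; split => /=.
- apply: nzd_px_px => r r' rrs; apply: contraTneq => <-.
  by have := rsP _ rrs; rewrite /srows /= mem_cat negb_or => /andP[].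
- rewrite scol_sforms -py_cat; apply: nzd_px_px_py => r r' rrs; apply: contraTneq => <-.
  by have := rsP _ rrs; rewrite /srows /= mem_cat negb_or => /andP[].
- have IE f : sI (sforms ((rs1, qs1) :: s)) f <-> IX (spts ((rs1, qs1) :: s)) f.
    by apply: iff_sym; apply: IX_sI.
  set I := fun f => _; have {}IE f : I f <-> IX (spts ((rs1, qs1) :: s)) f by apply: IE.
  have idI : is_ideal I by apply: (@is_ideal_sI S (sforms ((rs1, qs1) :: s))).
  have nzdE f : nzd (IX (spts ((rs1, qs1) :: s))) f -> nzd I f by move=> nf g /IE/nf/IE.
  apply: nzd_prod => q /qsP qs0; apply: nzd_adj_prod => // r /rsP rs0.
    by apply/nzdE/nzd_IX_lx/spts_row.
  move=> g /(adj_mono (fun h => proj1 (IE h))) H.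
  by apply: (adj_mono (fun h => proj2 (IE h))); apply: cms H; [exact: (spts_row rs0)|exact: (spts_col qs0)].
- apply: IH => //.
    by move=> r /rsP; rewrite /srows /= mem_cat negb_or => /andP[].
  by move=> q; apply: uniq_cat_notin uqs.
Qed.

(** The squares along the first rows give an expansion by [px_rect2], whose coefficients are free;
    the double points of the tail impose the hypothesis of [sJ_cons]. *)
Lemma IZ_sJ s f : sgood s -> IZ (spts s) f <-> sJ (sforms s) f.
Proof.
elim: s f => [|[rs qs] s IH] f; first by split.
move=> gs0; have [urs uqs _ cms gs] := gs0; have ur := uniq_cat_notin urs.
have Bpt P : P \in spts ((rs, qs) :: s) -> id2 (lx P.1) (ly P.2) (py (qs ++ scols s)).
  rewrite mem_cat => PY; apply: py_pt; case/orP: PY => [|/mem_spts[_ Pc]].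
    by case/allpairsP => -[r q] /= [_ qx ->].
  by rewrite mem_cat Pc orbT.
have subs P : P \in spts s -> P \in spts ((rs, qs) :: s) by rewrite mem_cat orbC => ->.
have nu : nzd (IZ (spts s)) (px rs).
  by apply: nzd_prod => r /ur/spts_row; apply: nzd_IZ_lx.
split=> [If|/= [c [i [j [Ii Jj ->]]]] P PY].
  have [c [d [e E]]] : sq2 (px rs) (py (qs ++ scols s)) f.
    apply: px_rect2 => //; first by move: urs; rewrite cat_uniq => /andP[].
    by move=> r q rrs qqs; apply: (If (r, q)); rewrite mem_cat allpairs_f.
  have -> : f = e * (py qs * scol (sforms s)) ^+ 2
      + px rs * (py qs * scol (sforms s)) * d + px rs ^+ 2 * c.
    by rewrite E scol_sforms py_cat; ring.
  apply: sJ_cons.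
  - by apply: IZ_sJ_aux => // q; apply: uniq_cat_notin uqs.
  - by move=> g /(IH _ gs)/nu/(IH _ gs).
  apply/(IH _ gs)/nu => P Ps; rewrite scol_sforms -py_cat.
  have -> : px rs * (py (qs ++ scols s) * d + px rs * c) =
      f - e * (py (qs ++ scols s) * py (qs ++ scols s)) by rewrite E; ring.
  have idP := is_ideal_sq2 (lx P.1) (ly P.2).
  apply: (is_idealB idP); first exact/If/subs.
  by apply: (is_idealMl _ idP); apply: id2M_sq2; apply/Bpt/subs.
rewrite scol_sforms -py_cat; have idP := is_ideal_sq2 (lx P.1) (ly P.2).
have Bp := Bpt P PY; move: Ii Jj => /(IX_sI _ gs) Ii /(IH _ gs) Jj.
rewrite expr2; apply: (is_idealD idP); [apply: (is_idealD idP)|].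
- by apply: (is_idealMl _ idP); apply: id2M_sq2.
- move: PY; rewrite mem_cat => /orP[|/Ii Pi]; last first.
    by rewrite -mulrA; apply: (is_idealMl _ idP); apply: id2M_sq2.
  case/allpairsP => -[r q] [/= rrs _ PE]; apply: (is_idealMr _ idP); apply: id2M_sq2 => //.
  by apply: px_pt; rewrite PE.
move: PY; rewrite mem_cat => /orP[|/Jj Pj]; last exact: (is_idealMl _ idP).
case/allpairsP => -[r q] [/= rrs _ PE]; apply: (is_idealMr _ idP); rewrite expr2.
by apply: id2M_sq2 => //; apply: px_pt; rewrite PE.
Qed.

Lemma sforms_ok s : sgood s -> stair_ok (sforms s).
Proof.
elim: s => [|[rs qs] s IH] //= [urs uqs [rs0 qs0] cms gs]; have ur := uniq_cat_notin urs.
split=> //=; last exact: IH.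
- by rewrite /px prodf_seq_neq0; apply/allP => r _; apply: lx_neq0.
- by rewrite scol_sforms -py_cat; apply: nzd_px_py.
- move=> g /(IX_sI _ gs) Ig; apply/(IX_sI _ gs); move: g Ig.
  by apply: nzd_prod => r /ur/spts_row; apply: nzd_IX_lx.
move=> y /mapP[[rs' qs'] xs ->] /=; apply: nzd_px_px => r r' /ur rs0'; apply: contraTneq => <-.
apply: contra rs0' => rrs; apply/flattenP; exists rs' => //.
by apply/mapP; exists (rs', qs').
Qed.

Hypothesis k_infinite : forall rs : seq T, exists r, r \notin rs.

Lemma sgood_col s q : sgood s -> q \in scols s -> exists r, (r, q) \in spts s.
Proof.
case: s => [//|[rs qs] s] [_ _ [rs0 _] _ _] qs0.
case: rs rs0 qs0 => // r rs _ qs0; exists r.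
by rewrite mem_cat; apply/orP; left; apply: allpairs_f; rewrite ?mem_head.
Qed.

Lemma sgood_row s r : sgood s -> r \in srows s -> exists q, (r, q) \in spts s.
Proof.
elim: s => [//|[rs qs] s IH] [_ _ [_ qs0] _ gs].
rewrite /srows /= mem_cat => /orP[rrs|/(IH gs)[q rq]]; last first.
  by exists q; rewrite mem_cat rq orbT.
case: qs qs0 => // q qs _; exists q.
by rewrite mem_cat; apply/orP; left; apply: allpairs_f; rewrite ?mem_head.
Qed.

(** The complete rows form the first block, together with the columns that no remaining point
    meets. *)
Lemma cm_staircase Y : cm Y -> exists s, sgood s /\ spts s =i Y.
Proof.
have [N] := ubnP (size Y); elim: N Y => // N IH Y; rewrite ltnS => szY cmY.
have [->|Y0] := eqVneq Y [::]; first by exists [::].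
have [r0 r0Y fr0] := cm_full_row k_infinite cmY Y0.
set Y' := [seq P <- Y | ~~ row_complete Y P.1].
have cmY' : cm Y' := cm_remove_rows k_infinite cmY.
have [|s [gs sE]] := IH Y' _ cmY'.
  apply: leq_trans szY; rewrite size_filter -(count_predC (fun P => row_complete Y P.1) Y).
  rewrite -[X in (X < _)%N]add0n ltn_add2r -has_count; apply/hasP.
  by case/mapP: r0Y => P PY PE; exists P; rewrite -?PE.
have cmE : cm (spts s).
  have IXE f : IX (spts s) f <-> IX Y' f by split=> H P PY; apply: H; rewrite ?sE // -sE.
  have mE Z Z' (h : T * T -> T) : Z =i Z' -> [seq h P | P <- Z] =i [seq h P | P <- Z'].
    by move=> ZE x; apply/mapP/mapP => -[P PZ ->]; exists P => //; rewrite ?ZE // -ZE.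
  move=> r q; rewrite /unzip1 /unzip2 !(mE _ _ _ sE) => rY qY g.
  move=> /(adj_mono (fun h => proj1 (IXE h)))/(cmY' r q rY qY).
  exact: (adj_mono (fun h => proj2 (IXE h))).
pose rs := [seq r <- undup (unzip1 Y) | row_complete Y r].
pose qs := [seq q <- undup (unzip2 Y) | q \notin scols s].
have rs0 : r0 \in rs by rewrite mem_filter fr0 mem_undup.
have colsE q : q \in qs ++ scols s = (q \in unzip2 Y).
  rewrite mem_cat mem_filter mem_undup; case: (boolP (q \in scols s)) => //=.
    move=> /(sgood_col gs)[r]; rewrite sE mem_filter => /andP[_ rq].
    by apply/esym; apply: (map_f snd rq).
  by rewrite orbF.
exists ((rs, qs) :: s); split.
  split=> //=.
  - rewrite cat_uniq filter_uniq ?undup_uniq //=; apply/andP; split.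
      apply/hasPn => r /(sgood_row gs)[q]; rewrite sE mem_filter => /andP[nf _].
      by rewrite mem_filter negb_and nf.
    by case: s gs {sE cmE qs colsE} => [|[rs1 qs1] s] // [].
  - rewrite cat_uniq filter_uniq ?undup_uniq //=; apply/andP; split.
      by apply/hasPn => q qs'; rewrite mem_filter qs'.
    by case: s gs {sE cmE qs colsE} => [|[rs1 qs1] s] // [].
  split; first by apply/eqP => E; rewrite E in rs0.
  (* Without a new column, a row that is complete among the remaining points would be complete in
     [Y] and would have been removed. *)
  apply/eqP => qs0; have [E|Y'0] := eqVneq Y' [::].
    case: Y Y0 @Y' @rs @qs sE E colsE qs0 {szY cmY r0Y fr0 cmY' rs0} => // P Y _ Y' rs qs sE E.
    move=> /(_ P.2) + qs0; rewrite qs0 /= mem_head => /(sgood_col gs)[r].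
    by rewrite sE E.
  have [r rY' fr] := cm_full_row k_infinite cmY' Y'0.
  case/mapP: rY' => P PY' rE; move: (PY'); rewrite mem_filter => /andP[/negP nf _]; apply: nf.
  apply/allP => q; rewrite -colsE qs0 /= => /(sgood_col gs)[r']; rewrite sE => r'q.
  have /(allP fr) : q \in unzip2 Y' by apply: (map_f snd r'q).
  by rewrite -rE mem_filter => /andP[].
move=> [r q]; rewrite /= mem_cat sE mem_filter; apply/orP/idP => [[|/andP[]//]|rqY].
  case/allpairsP => -[r' q'] [/= + + [-> ->]]; rewrite mem_filter => /andP[/allP fr _].
  by rewrite colsE => /fr.
have [fr|_] := boolP (row_complete Y r); [left|by right].
apply: allpairs_f; last by rewrite colsE; apply: (map_f snd rqY).
by rewrite mem_filter fr mem_undup; apply: (map_f fst rqY).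
Qed.

End StaircaseOfPoints.

(** * The Cohen-Macaulay hypothesis and initial degrees *)

Section CohenMacaulay.
Variable k : fieldType.
Local Notation S := {mpoly k[4]}.
Local Notation irr := (@irrelevant_ideal k 4).
Local Notation T := (option k).

Definition P1_class (R : P1 k) : T :=
  if val R 0 0 == 0 then None else Some (val R 0 1 / val R 0 0).

Lemma form_at_lform io (R : P1 k) : exists2 c : k, c != 0 &
  form_at (fun i => 'X_(io i)) R = c *: lform io (P1_class R).
Proof.
rewrite /form_at /P1_class /lform; have [R0|R0] := eqVneq (val R 0 0) 0.
  exists (val R 0 1); last by rewrite R0 /= !scale0r !subr0 scale1r.
  have := valP R; apply: contra => /eqP R1; apply/eqP/rowP => j; rewrite mxE.
  by have [->|->] : j = 0 \/ j = 1; [case: j => -[|[|//]] ?; [left|right]; apply: val_inj|..].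
by exists (val R 0 0) => //; rewrite scalerBr !scalerA mulrC divfK //= mulr1.
Qed.

Definition classes (X : seq (P1xP1 k)) : seq (T * T) :=
  [seq (P1_class P.1, P1_class P.2) | P <- X].

Lemma point_idealE P f : @point_ideal k P f <->
  id2 (lx (P1_class P.1)) (ly (P1_class P.2)) f.
Proof.
have [c c0 cE] := form_at_lform (@lshift 2 2) P.1.
have [d d0 dE] := form_at_lform (@rshift 2 2) P.2.
have scaleK (a : k) (g : S) : a != 0 -> g = a^-1%:MP * (a *: g).
  by move=> a0; rewrite mul_mpolyC scalerA mulVf // scale1r.
split=> [|[a [b ->]]].
  apply: ideal_gen_min => [|g [->|->]]; first exact: is_ideal_id2.
  - by exists c%:MP, 0; rewrite /xvar cE -mul_mpolyC /lx; ring.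
  - by exists 0, d%:MP; rewrite /yvar dE -mul_mpolyC /ly; ring.
have idP : is_ideal (point_ideal P) by apply: is_ideal_gen.
apply: (is_idealD idP); apply: (is_idealMl _ idP).
  rewrite (scaleK c (lx _)) // /lx -cE; apply: (is_idealMl _ idP).
  by apply: ideal_gen_in; left.
rewrite (scaleK d (ly _)) // /ly -dE; apply: (is_idealMl _ idP).
by apply: ideal_gen_in; right.
Qed.

Lemma points_idealE X f : points_ideal X f <-> IX (classes X) f.
Proof.
split=> [Xf _ /mapP[P PX ->]|Xf P PX]; first exact/point_idealE/Xf.
by apply/point_idealE/(Xf (_, _)); apply: (map_f (fun P => (P1_class P.1, P1_class P.2))).
Qed.

Lemma point_ideal2E P f : ideal_mul (@point_ideal k P) (point_ideal P) f <->
  sq2 (lx (P1_class P.1)) (ly (P1_class P.2)) f.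
Proof.
split=> [|[a [b [c ->]]]].
  apply: ideal_gen_min => [|_ [g [h [/point_idealE Pg /point_idealE Ph ->]]]].
    exact: is_ideal_sq2.
  exact: id2M_sq2.
have idP : is_ideal (ideal_mul (point_ideal P) (point_ideal P)) by apply: is_ideal_gen.
have Px : point_ideal P (lx (P1_class P.1)) by apply/point_idealE; exists 1, 0; ring.
have Py : point_ideal P (ly (P1_class P.2)) by apply/point_idealE; exists 0, 1; ring.
rewrite !expr2; apply: (is_idealD idP); [apply: (is_idealD idP)|];
  by apply: (is_idealMl _ idP); apply: ideal_gen_in; do 2!eexists; split=> //.
Qed.

Lemma double_points_idealE X f : double_points_ideal X f <-> IZ (classes X) f.
Proof.
split=> [Xf _ /mapP[P PX ->]|Xf P PX]; first exact/point_ideal2E/Xf.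
by apply/point_ideal2E/(Xf (_, _)); apply: (map_f (fun P => (P1_class P.1, P1_class P.2))).
Qed.

Lemma irr_maximal : is_maximal_ideal irr.
Proof.
split=> [||J idJ J1 irrJ f Jf]; [exact: is_ideal_irr|exact: not_irr1|].
apply/irrP/eqP; apply: contraT => f0; case: J1.
have -> : 1 = (f@_0%MM)^-1%:MP * (f - (f - (f@_0%MM)%:MP)) :> S.
  by rewrite opprB addrC subrK -mpolyCM mulVf // mpolyC1.
apply: is_idealMl => //; apply: is_idealB => //; apply: irrJ; apply/irrP.
by rewrite mcoeffB mcoeffC eqxx mulr1 subrr.
Qed.

Lemma principal_ly_prime q : is_prime_ideal (principal (@ly k q)).
Proof.
split=> [||a b]; first exact: is_ideal_principal.
  move=> /principalP[c E]; apply: (@not_irr1 k 4); rewrite E.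
  by apply: is_idealMr; [exact: is_ideal_irr|exact: lform_irr].
have rinj := @rshift_inj 2 2.
move=> /(principal_lform rinj)/eqP; rewrite rmorphM mulf_eq0.
by case/orP => /eqP E; [left|right]; apply/(principal_lform rinj).
Qed.

(** The chain is [(lx r, ly q) < (x_0, x_1, ly q) < irr]; the middle prime is the preimage of
    [(ly q)] under setting [x = 0]. *)
Lemma codim_chain (I : S -> Prop) r q : subideal I (id2 (lx r) (ly q)) ->
  exists c, prime_chain I irr 2 c.
Proof.
move=> Isub; have [r' rr'] := other_point r; have [q' qq'] := other_point q.
have idirr := @is_ideal_irr k 4.
pose c1 f := principal (@ly k q) (subst (@xzero k) f).
have [idp p1 pprime] := principal_ly_prime q.
exists (fun i => if i is 0 then id2 (lx r) (ly q) else if i is 1 then c1 else irr).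
split=> //.
- case=> [_|[_|i _]]; first exact: (pt_ideal_prime (r, q)).
    split; [|by rewrite /c1 rmorph1|by move=> a b; rewrite /c1 rmorphM => /pprime].
    split=> [|a b c1a c1b|a b c1b]; rewrite /c1 ?rmorph0 ?rmorphD ?rmorphM.
    - exact: (is_ideal0 idp).
    - exact: (is_idealD idp).
    - exact: (is_idealMl _ idp).
  split=> // [|a b]; first exact: not_irr1.
  move=> /irrP/eqP; rewrite rmorphM mulf_eq0.
  by case/orP => /eqP E; [left|right]; apply/irrP.
- case=> [_|[_|//]]; split.
  + move=> _ [a [b ->]]; rewrite /c1 rmorphD !rmorphM /= xzero_lx xzero_ly mulr0 add0r.
    by apply/principalP; exists (subst (@xzero k) b); rewrite mulrC.
  + exists (lx r'); first by rewrite /c1 xzero_lx; apply: is_ideal0.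
    have [_ id1 _] := pt_ideal_prime (r, q).
    by move=> H; apply: id1; apply: (@nzd_pt_lx k (r, q) r' rr'); rewrite mulr1.
  + move=> f /principalP[m E].
    rewrite -[f](subKr (subst (@xzero k) f)); apply: is_idealB => //.
      by rewrite E; apply: is_idealMr => //; apply: lform_irr.
    apply: subst_congr => // j; rewrite /xzero; case: (split _) => _.
      by rewrite sub0r; apply: is_idealN => //; apply: ideal_gen_in; exists j.
    by rewrite subrr; apply: is_ideal0.
  + exists (ly q'); first exact: lform_irr.
    rewrite /c1 xzero_ly; exact: (not_principal_lform (@rshift_inj 2 2) qq').
Qed.

Lemma ACM_cm (X : seq (P1xP1 k)) : is_ACM X -> cm (classes X).
Proof.
case: X => [|P X] XACM; first by move=> r q _ _ g _; apply: sub_adj.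
set I := points_ideal (P :: X).
have Isub : subideal I (id2 (lx (P1_class P.1)) (ly (P1_class P.2))).
  by move=> f If; apply/point_idealE/If; rewrite mem_head.
have idirr := @is_ideal_irr k 4.
have [|n [[[fs [[fs1 fsreg] fsm] fsn] _] [_ codim]]] := XACM irr irr_maximal.
  move=> f /Isub[a [b ->]].
  by apply: is_idealD => //; apply: is_idealMl => //; apply: lform_irr.
(* Depth equals codimension, which is at least 2, so the regular sequence has two leading members to
   keep. *)
have [c /codim] := codim_chain Isub; rewrite -fsn.
case: fs fs1 fsreg fsm {fsn codim XACM} => [|f1 [|f2 fs]] // _ freg fm _.
apply: depth_ge2_cm; exists f1, f2.
have IE f : I f <-> IX (classes (P :: X)) f := points_idealE (P :: X) f.
have idI := is_ideal_IX (classes (P :: X)).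
have id0 f : ideal_adjoin I [::] f <-> IX (classes (P :: X)) f.
  split; last by move=> /IE If; apply: ideal_gen_in; left.
  by apply: ideal_gen_min => [//|g [/IE|]]; rewrite ?in_nil.
have id1 f : ideal_adjoin I [:: f1] f <-> adj (IX (classes (P :: X))) f1 f.
  split=> [|[j [a [/IE Ij ->]]]].
    apply: ideal_gen_min => [|g [/IE|]]; [exact: is_ideal_adj|exact: sub_adj|].
    by rewrite inE => /eqP ->; exists 0, 1; rewrite mul1r add0r; split=> //; apply: is_ideal0 idI.
  have idA : is_ideal (ideal_adjoin I [:: f1]) by apply: is_ideal_gen.
  apply: (is_idealD idA); first by apply: ideal_gen_in; left.
  by apply: (is_idealMl _ idA); apply: ideal_gen_in; right; rewrite mem_head.
split; [by apply: fm; rewrite !inE eqxx|by apply: fm; rewrite !inE eqxx orbT| |].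
- by move=> g /id0 Ig; apply/id0; apply: (freg 0%N).
- by move=> g /id1 Ig; apply/id1; apply: (freg 1%N).
Qed.

End CohenMacaulay.

Section LowDegree.
Variables (k : fieldType) (n : nat).
Local Notation S := {mpoly k[n]}.

(** These elements form an ideal, so initial degrees can be bounded without tracking homogeneity. *)
Definition lowdeg N (f : S) : Prop := forall m, f@_m != 0 -> (N <= mdeg m)%N.

Lemma lowdegM N N' f g : lowdeg N f -> lowdeg N' g -> lowdeg (N + N') (f * g).
Proof.
move=> lf lg m; rewrite -mcoeff_msupp => /msuppM_le/allpairsP[[m1 m2] /= [m1f m2g ->]].
by rewrite mdegD leq_add ?lf ?lg // -mcoeff_msupp.
Qed.

Lemma is_ideal_lowdeg N : is_ideal (lowdeg N).
Proof.
split=> [m|f g lf lg m|f g lg]; first by rewrite mcoeff0 eqxx.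
  rewrite mcoeffD; have [->|/lf //] := eqVneq f@_m 0; rewrite add0r; exact: lg.
by rewrite -[N]add0n; apply: lowdegM.
Qed.

Lemma irr_lowdeg f : @irrelevant_ideal k n f -> lowdeg 1 f.
Proof.
by move=> /irr_coef0 f0 m; rewrite lt0n mdeg_eq0; apply: contra => /eqP ->; rewrite f0.
Qed.

Lemma homog_lowdeg N e f : f != 0 -> f \is e.-homog -> lowdeg N f -> (N <= e)%N.
Proof.
move=> f0 /dhomogP fe lf; have := mlead_supp f0; move=> mf.
by rewrite -(fe _ mf); apply: lf; rewrite -mcoeff_msupp.
Qed.

Lemma scol_lowdeg (w : seq (S * S)) : (forall x, x \in w -> lowdeg 1 x.2) ->
  lowdeg (size w) (scol w).
Proof.
elim: w => // x w IH xw /=; rewrite -add1n; apply: lowdegM.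
  by apply: xw; rewrite mem_head.
by apply: IH => y yw; apply: xw; rewrite in_cons yw orbT.
Qed.

Lemma sI_lowdeg (w : seq (S * S)) f :
  (forall x, x \in w -> lowdeg 1 x.1 /\ lowdeg 1 x.2) -> sI w f -> lowdeg (size w) f.
Proof.
elim: w f => // -[u v] w IH f xw [c [i [Ii ->]]].
have [lu lv] := xw _ (mem_head _ _).
have xw' x : x \in w -> lowdeg 1 x.1 /\ lowdeg 1 x.2.
  by move=> yw; apply: xw; rewrite in_cons yw orbT.
have idl := is_ideal_lowdeg (size w).+1; apply: (is_idealD idl).
  apply: (is_idealMl _ idl); apply: (lowdegM (N := 1)) => //.
  by apply: scol_lowdeg => x /xw'[].
by apply: (lowdegM (N := 1)) => //; apply: IH.
Qed.

Lemma sJ_lowdeg (w : seq (S * S)) f :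
  (forall x, x \in w -> lowdeg 1 x.1 /\ lowdeg 1 x.2) -> sJ w f -> lowdeg (2 * size w) f.
Proof.
elim: w f => // -[u v] w IH f xw [c [i [j [Ii Jj ->]]]].
have [lu lv] := xw _ (mem_head _ _).
have xw' x : x \in w -> lowdeg 1 x.1 /\ lowdeg 1 x.2.
  by move=> yw; apply: xw; rewrite in_cons yw orbT.
have lB : lowdeg (size w).+1 (v * scol w).
  by apply: (lowdegM (N := 1)) => //; apply: scol_lowdeg => x /xw'[].
have idl := is_ideal_lowdeg (2 * (size w).+1).
apply: (is_idealD idl); [apply: (is_idealD idl)|].
- by apply: (is_idealMl _ idl); rewrite expr2 mul2n -addnn; apply: lowdegM.
- have -> : (2 * (size w).+1 = 1 + (size w).+1 + size w)%N by lia.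
  by apply: lowdegM; [apply: lowdegM|apply: sI_lowdeg].
- have -> : (2 * (size w).+1 = 1 + 1 + 2 * size w)%N by lia.
  by apply: lowdegM; [rewrite expr2; apply: lowdegM|apply: IH].
Qed.

End LowDegree.

(** * The bound on the Betti numbers *)

Section StaircaseResolution.
Variables (k : fieldType) (n : nat) (w : seq ({mpoly k[n]} * {mpoly k[n]})).
Hypothesis w_ok : stair_ok w.
Local Notation S := {mpoly k[n]}.

Definition sres_rank i : nat :=
  match i with
  | 0 => 1 | 1 => rk1 (size w) | 2 => rk2 (size w) | 3 => rk3 (size w) | _ => 0
  end.

Definition sres_diff i : 'M[S]_(sres_rank i.+1, sres_rank i) :=
  match i with 0 => e1mx w | 1 => e2mx w | 2 => e3mx w | _ => 0 end.

(* The shifts are irrelevant: only the ranks are compared. *)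
Definition sres : free_complex k n :=
  @FreeComplex k n sres_rank (fun _ _ => 0%N) sres_diff.

Lemma sres_resolves (I : S -> Prop) : (forall f, I f <-> sJ w f) ->
  resolves_quotient I sres.
Proof.
move=> IE; split=> // [v|[|[|[|i]]] v].
- rewrite /= in v *; split=> [Iv|[u <-] b].
    by have /IE/sJ_e1mx[u uE] := Iv 0; exists u; rewrite uE -mx11_scalar.
  by apply/IE/sJ_e1mx; exists u; rewrite ord1 -mx11_scalar.
- split=> [|[u <-]]; first exact: e2mx_exact.
  by rewrite /= -mulmxA e2mx_e1mx mulmx0.
- split=> [|[u <-]]; first exact: e3mx_exact.
  by rewrite /= -mulmxA e3mx_e2mx mulmx0.
- split=> [/(e3mx_inj w_ok) ->|[u <-]]; first by exists 0; rewrite mul0mx.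
  by rewrite /= mulmx0 mul0mx.
- have -> : v = 0 by apply/rowP => j; have := ltn_ord j.
  by rewrite mul0mx; split=> // _; exists 0; rewrite mul0mx.
Qed.

Lemma sres_minimal : (0 < size w)%N ->
  (forall x, x \in w -> irrelevant_ideal x.1 /\ irrelevant_ideal x.2) ->
  is_minimal sres.
Proof.
have idI := @is_ideal_irr k n; move=> w_gt0 wI [|[|[|i]]] /=.
- exact: e1mx_in.
- exact: e2mx_in.
- exact: e3mx_in.
- by case.
Qed.

End StaircaseResolution.

Section Shifts.
Variables (k : fieldType) (n : nat) (F : free_complex k n).

(** No row of a differential is zero: a basis vector that is a cycle would be in the image of a
    minimal differential. A nonzero entry has degree at least [N] in the first map and at least 1
    afterwards. *)
Lemma fshift_ge (I : {mpoly k[n]} -> Prop) N :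
    graded_minimal_free_resolution I F -> (forall f, I f -> lowdeg N f) ->
  forall i (a : 'I_(frank F i.+1)), (N + i <= fshift a)%N.
Proof.
move=> [[F0 F0s exF0 exF] grF minF] IN.
have nz i (a : 'I_(frank F i.+1)) : exists b, fdiff F i a b != 0.
  apply/existsP; apply: contraT; rewrite negb_exists => /forallP a0.
  have /exF[u uE] : delta_mx 0 a *m fdiff F i = 0 :> 'rV_(frank F i).
    by rewrite -rowE; apply/rowP => b; rewrite !mxE; apply/eqP; rewrite -[_ == _]negbK.
  case: (@not_irr1 k n); have := minimal_fmap u a minF.
  by rewrite /fmap /= uE mxE !eqxx.
elim=> [|i IH] a; have [b ab0] := nz _ a; have [e -> e_homog] := grF _ _ _ ab0.
  rewrite addn0 F0s add0n; apply: homog_lowdeg ab0 e_homog _; apply: IN.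
  have /exF0/(_ b) : exists u, u *m fdiff F 0 = row a (fdiff F 0).
    by exists (delta_mx 0 a); rewrite rowE.
  by rewrite mxE.
rewrite addnS -addn1 leq_add ?IH //.
by apply: homog_lowdeg ab0 e_homog _; apply: irr_lowdeg; apply: minF.
Qed.

Lemma max_shift_ge i (a : 'I_(frank F i)) : (fshift a <= max_shift F i)%N.
Proof.
apply: (@leq_bigmax_seq _ _ _ (fun d => d)); first exact: codom_f.
by rewrite -lt0n; apply/card_gt0P; exists a; rewrite inE.
Qed.

Lemma total_bettiE i : total_betti F i = frank F i.
Proof.
rewrite /total_betti /graded_betti.
under eq_bigr => d _ do rewrite -sum1dep_card big_mkcond.
rewrite exchange_big /= -[RHS]card_ord -sum1_card; apply: eq_bigr => a _.
rewrite -big_mkcond /= (eq_bigl (pred1 (fshift a))) => [|d]; last exact: eq_sym.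
by rewrite sum1_count count_uniq_mem ?undup_uniq // mem_undup codom_f.
Qed.

End Shifts.

Lemma pchar0_infinite (k : fieldType) (rs : seq (option k)) : [pchar k] =i pred0 ->
  exists r, r \notin rs.
Proof.
move=> /pcharf0P char0; pose s := [seq Some (i%:R : k) | i <- iota 0 (size rs).+1].
have us : uniq s.
  rewrite map_inj_uniq ?iota_uniq // => i j [] /eqP; wlog ij : i j / (i <= j)%N.
    by move=> H; have [/H//|/ltnW/H] := leqP i j; rewrite eq_sym => HH /HH.
  by rewrite eq_sym -subr_eq0 -natrB // char0 subn_eq0 => ji; apply/eqP; rewrite eqn_leq ij.
have [/allP sub|/allPn[r _ rrs]] := boolP (all (mem rs) s); last by exists r.
by have := uniq_leq_size us sub; rewrite size_map size_iota ltnn.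
Qed.

(** Truncating [F] gives [p <= q]. If [p < q], comparison with a resolution of length [p] kills [F]
    in degree [p.+1], and then in all later degrees, including [q]. *)
Lemma projdim_eq (k : fieldType) n (I : {mpoly k[n]} -> Prop)
    (M : lmodType {mpoly k[n]}) (pi : {linear {mpoly k[n]}^o -> M})
    (F : free_complex k n) p q :
    is_quotient_map I pi -> is_projdim M p ->
    resolves_quotient I F -> is_minimal F ->
  frank F q != 0%N -> frank F q.+1 = 0%N -> p = q.
Proof.
move=> piI [resp minp] resF minF Fq Fq1; apply/eqP; rewrite eqn_leq.
rewrite (minp _ (truncate_resolution piI resF minF Fq1)) /= leqNgt; apply/negP => pq.
have Fp := projective_resolution_rank0 piI resF minF resp.
case/eqP: Fq; rewrite -(subnK pq); elim: (_ - _)%N => // m IH.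
by rewrite addSn; apply: minimal_rank0 resF minF IH.
Qed.

Lemma ler_nat_quotient (a b c : nat) : (0 < c)%N -> (c * b <= a)%N ->
  b%:R <= c%:R^-1 * a%:R :> rat.
Proof. by move=> c0 cba; rewrite ler_pdivlMl ?ltr0n // -natrM ler_nat. Qed.

Theorem theorem6p1 (k : closedFieldType) (char0 : [pchar k] =i pred0)
    (X : seq (P1xP1 k)) (X_ACM : is_ACM X)
    (* [M] is the S-module S/I_Z *)
    (M : lmodType {mpoly k[4]}) (pi : {linear {mpoly k[4]}^o -> M})
    (M_quot : is_quotient_map (double_points_ideal X) pi)
    (p : nat) (p_projdim : is_projdim M p)
    (F : free_complex k 4)
    (F_res : graded_minimal_free_resolution (double_points_ideal X) F)
    (i : nat) (i_bounds : (1 <= i <= p)%N) :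
  (total_betti F i)%:R <=
    ((i - 1)`! * (p - i)`!)%:R^-1
      * \prod_(1 <= j < p.+1 | j != i) (max_shift F j)%:R :> rat.
Proof.
have k_inf rs := pchar0_infinite rs char0.
have [s [gs sE]] := cm_staircase k_inf (ACM_cm X_ACM).
pose w := sforms s; have okw : stair_ok w := sforms_ok gs.
have IE f : double_points_ideal X f <-> sJ w f.
  apply: (iff_trans (double_points_idealE X f)); apply: (iff_trans _ (IZ_sJ f gs)).
  by split=> H P PY; apply: H; rewrite ?sE // -sE.
have [resF grF minF] := F_res.
have resG := sres_resolves okw IE.
have size_w : size w = size s by rewrite size_map.
have s_gt0 : (0 < size w)%N.
  (* With no blocks the ideal would contain 1, the image of a vector under a differential with
     entries in the irrelevant ideal. *)
  rewrite lt0n; apply/eqP => w0; have {w0} w0 : w = [::] by apply: size0nil.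
  have [F0 _ exF0 _] := resF.
  have [|u uE] := (exF0 (const_mx 1)).1; first by move=> b; apply/IE; rewrite w0.
  have b0 : 'I_(frank F 0) by rewrite F0; exact: ord0.
  case: (@not_irr1 k 4); have := minimal_fmap u b0 minF.
  by rewrite /fmap /= uE mxE.
have irr_w x : x \in w -> irrelevant_ideal x.1 /\ irrelevant_ideal x.2.
  have idI := @is_ideal_irr k 4.
  elim: s gs @w {sE okw IE resG size_w s_gt0} => [|[[|r rs] [|q qs]] s IH] // [_ _ [] //= _ _ _ gs].
  rewrite in_cons => /orP[/eqP -> /=|/IH]; last exact.
  by rewrite /px /py !big_cons; split; apply: is_idealMr => //; apply: lform_irr.
have minG := sres_minimal s_gt0 irr_w.
have rankE j : frank F j = sres_rank w j.
  apply/eqP; rewrite eqn_leq (minimal_rank_le M_quot j resF resG minF).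
  exact: (minimal_rank_le M_quot j resG resF minG).
have low f : double_points_ideal X f -> lowdeg (2 * size w) f.
  move=> /IE; apply: sJ_lowdeg => x /irr_w[x1 x2].
  by split; apply: irr_lowdeg.
have Mge j : (0 < frank F j.+1)%N -> (2 * size w + j <= max_shift F j.+1)%N.
  move=> Fj; apply: leq_trans (max_shift_ge (Ordinal Fj)).
  exact: (fshift_ge F_res low).
rewrite total_bettiE rankE; set t := size w in s_gt0 Mge *.
have r1 := rk1E t; have r2 := rk2E t; have r3 := rk3E t.
have M1 : (2 * t <= max_shift F 1)%N by rewrite -[X in (X <= _)%N]addn0 Mge // rankE /= -/t; lia.
have M2 : (2 * t + 1 <= max_shift F 2)%N by rewrite Mge // rankE /= -/t; nia.
rewrite -natr_prod; apply: ler_nat_quotient; first by rewrite muln_gt0 !fact_gt0.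
(* For [t = 1] the ranks 3 and 2 are exactly the lower bounds for [M_2] and [M_1]. *)
have [t1|t_gt1] := leqP t 1.
  have {s_gt0} t1 : t = 1%N by lia.
  have p2 : p = 2%N.
    apply: (projdim_eq M_quot p_projdim resF minF); rewrite rankE /= -/t.
      by rewrite r2 t1.
    by move: r3; rewrite t1; lia.
  rewrite t1 in r1 r2 M1 M2; rewrite p2 in i_bounds *.
  case: i i_bounds => [|[|[|//]]] // _; rewrite /index_iota /= !big_cons big_nil /= -/t t1 !subSS !subn0 ?factS fact0.
    by lia.
  by lia.
have p3 : p = 3%N.
  apply: (projdim_eq M_quot p_projdim resF minF); rewrite rankE //= -/t.
  by rewrite -lt0n; nia.
have M3 : (2 * t + 2 <= max_shift F 3)%N by rewrite Mge // rankE /= -/t; nia.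
(* The factorial products for [i = 1, 2, 3] are 2, 1, 2, which match the denominators in the ranks,
   so each bound follows from [M_j >= 2t + j - 1]. *)
rewrite p3 in i_bounds *.
case: i i_bounds => [|[|[|[|//]]]] // _; rewrite /index_iota /= !big_cons big_nil /= -/t !subSS !subn0 ?factS fact0.
- have : ((2 * t + 1) * (2 * t + 2) <= max_shift F 2 * max_shift F 3)%N by exact: leq_mul.
  by rewrite muln1; nia.
- have : (2 * t * (2 * t + 2) <= max_shift F 1 * max_shift F 3)%N by exact: leq_mul.
  by rewrite muln1; nia.
- have : (2 * t * (2 * t + 1) <= max_shift F 1 * max_shift F 2)%N by exact: leq_mul.
  by rewrite muln1; nia.
Qed.
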